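(* Let $(\mathfrak h,(H_i,L_i)_{i\in I})$ be a linear Coxeter system with linear Coxeter group $\mathcal W$, closed fundamental chamber $\overline C$ and Tits cone $X$. (a) Let $\Theta\subseteq I$ be special facial. The relative interior of $R(\Theta)$ is given by $$\mathrm{ri}(R(\Theta))=\mathcal W_{\Theta^\bot}\bigcup_{\Theta_f\subseteq\Theta^\bot,\ (\Theta_f)^0=\Theta_f}F_{\Theta\cup\Theta_f}.$$ (b) Every $\mathcal W$-orbit of $\mathrm{Fa}(X)$ contains exactly one of the faces $R(\Theta)$, $\Theta$ special facial. A face $R\in\mathrm{Fa}(X)$ is of the form $R(\Theta)$, $\Theta$ special facial, if and only if $\mathrm{ri}(R)\cap\overline C\neq\emptyset$.
   Context: $\mathbb R^+_0=[0,\infty)$, $\mathbb R^+=(0,\infty)$. A convex cone is a subset of a real vector space closed under addition and under multiplication by elements of $\mathbb R^+$. $\mathrm{ri}$ denotes the relative interior of a finite-dimensional convex set. For a convex cone $K$ containing $0$, a face of $K$ is a convex cone $F\subseteq K$ with $(K\setminus F)+K\subseteq K\setminus F$; $\mathrm{Fa}(K)$ is the set of nonempty faces, ordered by inclusion. Linear Coxeter systems. Let $\mathfrak h$ be a finite-dimensional real vector space, $n\ge1$, $I=\{1,\dots,n\}$. For a zero-based closed ray $H\subseteq\mathfrak h$ put $H^{\ge0}=\{\lambda\in\mathfrak h^*\mid\lambda(h)\ge0\ \forall h\in H\}$, $H^{>0}=\{\lambda\mid\lambda(h)>0\ \forall h\in H\setminus\{0\}\}$, $H^{=0}=\{\lambda\mid\lambda(h)=0\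 \forall h\in H\}$. A linear Coxeter system $(\mathfrak h,(H_i,L_i)_{i\in I})$ consists of zero-based closed rays $H_i\subseteq\mathfrak h$, $L_i\subseteq\mathfrak h^*$ with $L_i\setminus\{0\}\subseteq H_i^{>0}$ such that: (1) the closed fundamental chamber $\overline C=\bigcap_{i\in I}H_i^{\ge0}$ spans $\mathfrak h^*$, and $\overline C\cap H_i^{=0}$, $i\in I$, are its pairwise different faces of codimension 1; (2) with $C=\bigcap_{i\in I}H_i^{>0}$ and $\mathcal W$ (the linear Coxeter group) the group generated by the reflections $\sigma_i$ on $\mathfrak h^*$ at the hyperplane $H_i^{=0}$ along the line $L_i\cup(-L_i)$, one has $\sigma C\cap C=\emptyset$ for all $\sigma\in\mathcal W\setminus\{1\}$. Then $(\mathcal W,(\sigma_i)_{i\in I})$ is a Coxeter system; $\mathcal W_J$ is the subgroup generated by $\sigma_j$, $j\in J$. The Tits cone is the convex cone $X=\bigcup_{\sigma\in\mathcal W}\sigma\overline C$. For each $i$ fix $h_i\in H_i$, $\alpha_i\in L_i$ with $\alpha_i(h_i)=2$ (nothing below depends on the choice), and set $A=(a_{ij})_{i,j\in I}$, $a_{ij}=\alpha_j(h_i)$. For $J\subseteq I$ set $F_J=\{\lambda\in\mathfrak h^*\mid\lambda(h_i)=0\ (i\in J),\ \lambda(h_i)>0\ (i\in I\setminus J)\}$ and $\overline F_J=\{\lambda\in\mathfrak h^*\mid\lambda(h_i)=0\ (i\in J),\ \lambda(h_i)\ge0\ (i\in I\setminus J)\}$. $J\subseteq I$ is facial if $\sum_{j\in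 J}\mathbb R^+_0h_j$ is a face of $\sum_{i\in I}\mathbb R_0^+h_i$ (empty sum $=\{0\}$). Sets $J,K\subseteq I$ are separated if $a_{jk}=0$ for all $j\in J,k\in K$; a nonempty set is connected if it is not a disjoint union of two nonempty separated subsets; connected components are the maximal nonempty connected subsets. A nonempty connected $J$ is of finite, affine, indefinite type if there is $u\in(\mathbb R^+)^J$ such that all entries of $(a_{ij})_{i,j\in J}\,u$ are positive, zero, negative, respectively (exactly one case occurs). $J^0$ is the union of the finite type components of $J$, $J^\infty$ the union of the non-finite type components. $J$ is special if $J^\infty=J$ (so $\emptyset$ is special). Special facial means special and facial. $J^\bot=\{i\in I\mid a_{ij}=0\ \forall j\in J\}$. For $\Theta$ special facial, $R(\Theta):=\mathcal W_{\Theta^\bot}\overline F_\Theta$, which is a face of $X$. *)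

(* Defs.v *)
From HB Require Import structures.
From mathcomp Require Import all_boot all_order all_algebra.
From mathcomp Require Import all_classical all_reals all_analysis.
Import Order.TTheory GRing.Theory Num.Theory.
Import numFieldNormedType.Exports.
Import VectorInternalTheory.

Set Implicit Arguments.
Unset Strict Implicit.
Unset Printing Implicit Defensive.

Local Open Scope classical_set_scope.
Local Open Scope ring_scope.

Section Convexity.
Context {R : realType} {V : vectType R}.
Implicit Types (K F S : set V).

Definition convex_cone K : Prop :=
  (forall x y, K x -> K y -> K (x + y)) /\
  (forall (t : R) x, 0 < t -> K x -> K (t *: x)).

(* The empty set is a face. *)
Definition is_face K F : Prop :=
  [/\ convex_cone F, F `<=` K &
      forall x y, (K `\` F) x -> K y -> (K `\` F) (x + y)].

Definition Fa K : set (set V) := [set F | is_face K F /\ F !=set0].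

Definition is_span S (U : {vspace V}) : Prop :=
  (forall x, S x -> x \in U) /\
  (forall U' : {vspace V}, (forall x, S x -> x \in U') -> (U <= U')%VS).

(* A nonempty face of a cone containing 0 contains 0, so that its affine hull
   is its linear span. *)
Definition codim1_face K F : Prop :=
  Fa K F /\ exists UK UF : {vspace V},
    [/\ is_span K UK, is_span F UF & (\dim UF).+1 = \dim UK].

Definition affine_hull S : set V :=
  [set y | exists (k : nat) (x : 'I_k -> V) (c : 'I_k -> R),
     [/\ forall i, S (x i), \sum_(i < k) c i = 1
       & y = \sum_(i < k) c i *: x i]].

(* A vectType carries no topology; the one of V is transported from 'rV[R]_n
   along the linear isomorphism v2r, whose inverse is r2v. *)
Definition relint S : set V :=
  [set x | S x /\ \forall p \near v2r x, affine_hull S (r2v p) -> S (r2v p)].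

Definition closed_ray S : Prop :=
  exists2 v : V, v != 0 & S = [set t *: v | t in [set t : R | 0 <= t]].

(* These conditions determine s when the line is a complement of the hyperplane. *)
Definition is_reflection (hyperplane line : set V) (s : 'End(V)) : Prop :=
  (forall x, hyperplane x -> s x = x) /\ (forall x, line x -> s x = - x).

Definition is_subgroup (G : set 'End(V)) : Prop :=
  [/\ forall g, G g -> lker g = 0%VS,
      G \1%VF,
      forall g g', G g -> G g' -> G (g \o g')%VF
    & forall g, G g -> G (g^-1)%VF].

Definition generated_group (S : set 'End(V)) : set 'End(V) :=
  smallest is_subgroup S.

Definition translates (G : set 'End(V)) S : set V :=
  [set w x | w in G & x in S].

End Convexity.

Section LinearCoxeterSystem.
Context {R : realType} {V : vectType R} {n : nat}.
Local Notation Vd := 'Hom(V, R^o).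

Definition ray_ge0 (H : set V) : set Vd := [set l | forall h, H h -> 0 <= l h].
Definition ray_gt0 (H : set V) : set Vd :=
  [set l | forall h, H h -> h <> 0 -> 0 < l h].
Definition ray_eq0 (H : set V) : set Vd := [set l | forall h, H h -> l h = 0].

Variables (H : 'I_n -> set V) (L : 'I_n -> set Vd).

Definition closed_chamber : set Vd := \bigcap_i ray_ge0 (H i).
Definition open_chamber : set Vd := \bigcap_i ray_gt0 (H i).

Definition is_sigma (i : 'I_n) : set 'End(Vd) :=
  is_reflection (ray_eq0 (H i)) (L i `|` [set - l | l in L i]).

Definition parabolic (J : {set 'I_n}) : set 'End(Vd) :=
  generated_group [set s | exists2 i, i \in J & is_sigma i s].

Definition coxeter_group : set 'End(Vd) := parabolic [set: 'I_n]%SET.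

Definition tits_cone : set Vd := translates coxeter_group closed_chamber.

Record linear_coxeter_system : Prop := LinearCoxeterSystem {
  lcs_rank_gt0 : (0 < n)%N;
  lcs_H_ray : forall i, closed_ray (H i);
  lcs_L_ray : forall i, closed_ray (L i);
  lcs_L_gt0 : forall i, L i `\ 0 `<=` ray_gt0 (H i);
  lcs_chamber_span : is_span closed_chamber fullv;
  lcs_wall_inj : injective (fun i => closed_chamber `&` ray_eq0 (H i));
  lcs_walls : range (fun i => closed_chamber `&` ray_eq0 (H i)) =
              codim1_face closed_chamber;
  lcs_free : forall s, coxeter_group s -> s <> \1%VF ->
             [set s l | l in open_chamber] `&` open_chamber = set0 }.

End LinearCoxeterSystem.

Section Types.
Context {R : realType} {n : nat}.
Variable A : 'M[R]_n.
Implicit Types J K : {set 'I_n}.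

Definition separated J K : bool :=
  [forall j in J, forall k in K, A j k == 0].

Definition connected_set J : bool :=
  (J != finset.set0) &&
  ~~ [exists J1 : {set 'I_n}, exists J2 : {set 'I_n},
        [&& J1 != finset.set0, J2 != finset.set0, [disjoint J1 & J2],
            J == (J1 :|: J2)%SET & separated J1 J2]].

Definition connected_component_of J K : bool :=
  maxset (fun K' : {set 'I_n} => connected_set K' && (K' \subset J)) K.

(* Only meaningful when J is nonempty and connected. *)
Definition finite_type J : Prop :=
  exists u : 'I_n -> R, (forall j, j \in J -> 0 < u j) /\
    (forall i, i \in J -> 0 < \sum_(j in J) A i j * u j).

(* J^0 and J^oo *)
Definition fin_part J : {set 'I_n} :=
  (\bigcup_(K : {set 'I_n} | connected_component_of J K && `[< finite_type K >])
     K)%SET.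
Definition inf_part J : {set 'I_n} :=
  (\bigcup_(K : {set 'I_n} | connected_component_of J K && ~~ `[< finite_type K >])
     K)%SET.

Definition special J : Prop := inf_part J = J.

Definition perp J : {set 'I_n} :=
  [set i | [forall j in J, A i j == 0]]%SET.

End Types.

Section Faces.
Context {R : realType} {V : vectType R} {n : nat}.
Local Notation Vd := 'Hom(V, R^o).
Variables (H : 'I_n -> set V) (L : 'I_n -> set Vd).
Variables (h : 'I_n -> V) (alpha : 'I_n -> Vd).
Implicit Types J : {set 'I_n}.

Definition cartan_mx : 'M[R]_n := \matrix_(i, j) (alpha j (h i) : R).

Definition open_face J : set Vd :=
  [set l | forall i, if i \in J then l (h i) = 0 else 0 < l (h i)].
Definition closed_face J : set Vd :=
  [set l | forall i, if i \in J then l (h i) = 0 else 0 <= l (h i)].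

Definition cone_of J : set V :=
  [set x | exists c : 'I_n -> R,
     (forall j, j \in J -> 0 <= c j) /\ x = \sum_(j in J) c j *: h j].

Definition facial J : Prop := is_face (cone_of [set: 'I_n]%SET) (cone_of J).

Definition special_facial J : Prop := special cartan_mx J /\ facial J.

Definition Rface (Theta : {set 'I_n}) : set Vd :=
  translates (parabolic H L (perp cartan_mx Theta)) (closed_face Theta).

End Faces.

(* Main.v *)
(** A linear functional b = sum_(j in Theta) c_j h_j with c_j > 0 and
    alpha_i(b) <= 0 for all i (it exists because Theta is special) can only grow
    along W-orbits starting in the closed chamber.  Hence b is nonnegative on
    the Tits cone X, and an induction on words shows that X /\ {b = 0} is
    R(Theta), which is therefore an exposed face.

    For convex cones with apex 0 the relative interior has a purely algebraic
    description: x is in ri K iff for every y in K some x - t y with t > 0 is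
    still in K.  For l in F_(Theta u J), J of finite type and orthogonal to
    Theta, let v = sum_(j in J) u_j alpha_j with u_j > 0 and A_J u > 0.  Then
    l + t v is in F_Theta for small t > 0, so the point is that l - t v is in
    R(Theta) too.  Otherwise the directions pointing from l into R(Theta) form a
    proper W_J-invariant cone, whose dual cone D is nonzero; since A_J u > 0,
    every element of D can be reflected to one of uniformly smaller height, so
    that W_J would contain elements contracting the span of D, whereas they act
    on it with determinant 1 or -1. *)

From HB Require Import structures.
Require Import Defs.
From mathcomp Require Import all_boot all_order all_algebra.
From mathcomp Require Import all_classical all_reals all_analysis.
From mathcomp Require Import perm ring lra.

Import Order.TTheory GRing.Theory Num.Theory.
Import numFieldNormedType.Exports.
Import VectorInternalTheory.

Set Implicit Arguments.
Unset Strict Implicit.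
Unset Printing Implicit Defensive.

Local Open Scope classical_set_scope.
Local Open Scope ring_scope.

(** * Separation of convex cones *)

(** The two notions of type produce vectors on opposite sides of the matrix A: finite type a vector
    u > 0 with A u > 0, used as a combination of the [alpha i]; infinite type a vector c > 0 with c
    A <= 0, used as a combination of the [h i]. Evaluating c A u in both orders on an overlap is
    contradictory. This keeps finite and infinite parts apart, recovers Theta from its face and
    makes Theta unique in an orbit. Neither the [h i] nor the [alpha i] need be linearly
    independent, and for J of finite type neither finiteness of W_J nor an invariant form is at
    hand; hence the contraction argument, carried out on coordinate vectors instead of the span of
    the [alpha i]. The sign conditions on A and the exchange condition are not assumed but extracted
    from freeness of the action on chambers. *)

Section Separation.
Context {F : realFieldType} {V : vectType F}.
Implicit Types (U : {vspace V}) (g : V).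

(** For the number [N] below, [|y i|] < [N * x i] wherever [x i] is positive, so the single bound
    [N^-1] serves all these indices. *)
Lemma small_perturbation (I : finType) (x y : I -> F) :
  exists2 e : F, 0 < e &
    forall e' i, 0 <= e' <= e -> 0 < x i -> 0 < x i + e' * y i.
Proof.
pose N := 1 + \sum_i `|y i| / `|x i|.
have N0 : 0 < N by rewrite ltr_pwDl // sumr_ge0 // => i _; rewrite divr_ge0.
exists N^-1; first by rewrite invr_gt0.
move=> e' i /andP[e0 eN] xi.
have yN : `|y i| < N * x i.
  rewrite -ltr_pdivrMr // -(gtr0_norm xi) /N.
  by rewrite (bigD1 i) //= ltr_pwDl // lerDl sumr_ge0 // => j _;
    rewrite divr_ge0.
have : e' * `|y i| < x i.
  apply: (le_lt_trans (y := N^-1 * `|y i|)); first by rewrite ler_wpM2r.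
  by rewrite ltr_pdivrMl.
have : - (e' * `|y i|) <= e' * y i.
  by rewrite -mulrN ler_wpM2l // lerNl -normrN ler_norm.
by lra.
Qed.

Lemma functional_neq0 g : g != 0 -> exists l : 'Hom(V, F^o), l g = 1.
Proof.
move=> g0; exists (linfun (coord [tuple g] ord0 : V -> F^o)); rewrite lfunE /=.
have fr : free [tuple g] by rewrite /= seq1_free.
by rewrite -[X in coord _ _ X]/([tuple g]`_(@ord0 0)) coord_free.
Qed.

Lemma functional_notin U g : g \notin U ->
  exists2 l : 'Hom(V, F^o), l g = 1 & forall x, x \in U -> l x = 0.
Proof.
move=> gU; have g0 : g - projv U g != 0.
  by apply: contra gU; rewrite subr_eq0 => /eqP ->; exact: memv_proj.
have [l lg] := functional_neq0 g0.
exists (l \o (\1 - projv U))%VF; first by rewrite comp_lfunE !lfunE /= !lfunE.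
by move=> x xU; rewrite comp_lfunE !lfunE /= !lfunE /= projv_id // subrr
  linear0.
Qed.

(* Fourier-Motzkin style: if the functional found for [P :\ i] is negative at
   [x i], project along [x i] onto its kernel and apply induction again. *)
Lemma farkas (I : finType) (P : {set I}) (x : I -> V) g :
  (exists2 c : I -> F, forall i, i \in P -> 0 <= c i &
                       g = \sum_(i in P) c i *: x i) \/
  (exists2 l : 'Hom(V, F^o), forall i, i \in P -> 0 <= l (x i) & l g < 0).
Proof.
move cP : #|P| => k; elim: k P cP x g => [|k IH] P cP x g.
  have P0 i : i \in P = false by rewrite (cards0_eq cP) inE.
  have [->|/functional_neq0[l lg]] := eqVneq g 0.
    left; exists (fun=> 0) => //; rewrite big1 // => i.
    by rewrite P0.
  right; exists (- l) => [i|]; first by rewrite P0.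
  by rewrite opp_lfunE lg oppr_lt0.
have [i iP] : exists i, i \in P by apply/set0Pn; rewrite -card_gt0 cP.
have cPi : #|(P :\ i)%SET| = k by move: cP; rewrite (cardsD1 i) iP => -[].
have inPi j : j \in (P :\ i)%SET = (j != i) && (j \in P) by rewrite !inE.
have [[c c0 ->]|[l l0 lg]] := IH _ cPi x g.
  left; exists (fun j => if j == i then 0 else c j).
    by move=> j jP; case: eqVneq => // ji; apply: c0; rewrite inPi ji.
  rewrite [RHS](big_setD1 i) //= eqxx scale0r add0r; apply: eq_bigr => j.
  by rewrite inPi => /andP[/negPf ->].
have [li|li] := leP 0 (l (x i)).
  right; exists l => // j jP.
  by have [->//|ji] := eqVneq j i; apply: l0; rewrite inPi ji.
pose a := - (l (x i))^-1.
have a0 : 0 < a by rewrite oppr_gt0 invr_lt0.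
have al : a * l (x i) = -1 by rewrite mulNr mulVf // lt_eqF.
pose p y := y + (a * l y) *: x i.
have [[c c0 gE]|[m m0 mg]] := IH _ cPi (fun j => p (x j)) (p g).
  left; pose ci := a * (\sum_(j in (P :\ i)%SET) c j * l (x j) - l g).
  exists (fun j => if j == i then ci else c j).
    move=> j jP; case: eqVneq => ji; last by apply: c0; rewrite inPi ji.
    rewrite mulr_ge0 ?(ltW a0) // subr_ge0 (le_trans (ltW lg)) // sumr_ge0 // =>
      k0 k0P.
    by rewrite mulr_ge0 ?c0 ?l0.
  rewrite [RHS](big_setD1 i) //= eqxx.
  rewrite (eq_bigr (fun j => c j *: x j)); last first.
    by move=> j; rewrite inPi => /andP[/negPf ->].
  have -> : g = p g - (a * l g) *: x i by rewrite addrK.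
  rewrite gE /p (eq_bigr (fun j => c j *: x j + (c j * (a * l (x j))) *: x i)).
    rewrite big_split /= -scaler_suml -addrA addrC -scalerBl;
      congr (_ *: _ + _).
    rewrite /ci mulrBr mulr_sumr; congr (_ - _); apply: eq_bigr => j _.
    by rewrite mulrCA.
  by move=> j _; rewrite scalerDr scalerA.
right; exists (m + (a * m (x i)) *: l).
  have E y : (m + (a * m (x i)) *: l) y = m (p y).
    rewrite add_lfunE scale_lfunE linearD linearZ /=.
    by rewrite /GRing.scale /= mulrAC.
  move=> j jP; rewrite E; have [->|ji] := eqVneq j i.
    by rewrite /p al scaleN1r subrr linear0.
  by apply: m0; rewrite inPi ji.
rewrite add_lfunE scale_lfunE; move: mg; rewrite /p linearD linearZ /=.
by rewrite /GRing.scale /= mulrAC.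
Qed.

(** If some [- x i] lies in the cone of all [x j], it gives the relation. Otherwise Farkas yields,
    for each [i], a functional nonnegative on the family and positive at [x i]; their sum is
    positive everywhere. *)
Lemma gordan (I : finType) (x : I -> V) :
  (exists l : 'Hom(V, F^o), forall i, 0 < l (x i)) \/
  (exists c : I -> F, [/\ forall i, 0 <= c i, exists i, 0 < c i &
                          \sum_i c i *: x i = 0]).
Proof.
have [[i [c c0 cE]]|h] := pselect (exists i, exists2 c : I -> F,
    forall j, j \in [set: I]%SET -> 0 <= c j &
    - x i = \sum_(j in [set: I]%SET) c j *: x j).
  right; exists (fun j => c j + (j == i)%:R); split.
  - by move=> j; rewrite addr_ge0 ?c0 // inE.
  - by exists i; rewrite eqxx ltr_wpDl ?c0 // inE.
  rewrite (eq_bigr (fun j => c j *: x j + (j == i)%:R *: x j)) => [|j _].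
    rewrite big_split /= (eq_bigl (mem [set: I]%SET)).
    rewrite -cE (bigD1 i) //= eqxx scale1r big1 ?addr0 ?addNr // => j /negPf ->.
    by rewrite scale0r.
    by move=> j; rewrite !inE.
  by rewrite scalerDl.
left.
have /choice[l lP] : forall i, exists l : 'Hom(V, F^o),
    (forall j, 0 <= l (x j)) /\ 0 < l (x i).
  move=> i; have [hc|[l l0 li]] := farkas [set: I]%SET x (- x i).
    by case: h; exists i.
  exists l; split; first by move=> j; apply: l0; rewrite inE.
  by move: li; rewrite linearN oppr_lt0.
exists (\sum_i l i) => i; rewrite sum_lfunE (bigD1 i) //=.
by rewrite ltr_pwDl ?(lP i).2 // sumr_ge0 // => j _; exact: (lP j).1.
Qed.

End Separation.

Section HahnBanach.
Context {R : realType} {V : vectType R}.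

(* Hahn-Banach: the functional is extended one dimension at a time. *)
Lemma convex_cone_separation (Z : set V) (u : V) : convex_cone Z ->
    (forall x, exists2 t, 0 < t & Z (u + t *: x)) -> ~ Z (- u) ->
  exists l : 'Hom(V, R^o), l u = 1 /\ forall z, Z z -> 0 <= l z.
Proof.
move=> [ZD ZZ] ou Zu.
have uZ : Z u by have [t _] := ou 0; rewrite scaler0 addr0.
(* [u] is an order unit of [Z]. This is what makes the set [S] of lower bounds below nonempty and
   bounded above. *)
have bnd q : exists2 t, 0 < t & Z (t *: u + q).
  have [t t0 /(ZZ t^-1)] := ou q.
  rewrite invr_gt0 scalerDr scalerA mulVf ?gt_eqF // scale1r => /(_ t0) h.
  by exists t^-1; rewrite ?invr_gt0.
suff ext k : forall U : {vspace V}, u \in U -> (\dim {:V} - \dim U = k)%N ->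
    (exists l : 'Hom(V, R^o), l u = 1 /\ forall z, z \in U -> Z z -> 0 <= l z)
      ->
    exists l : 'Hom(V, R^o), l u = 1 /\ forall z, Z z -> 0 <= l z.
  apply: (ext _ <[u]>%VS (memv_line u) erefl).
  have u0 : u != 0.
    by apply/eqP => u0; move: Zu uZ; rewrite u0 oppr0.
  have [l lu] := functional_neq0 u0.
  exists l; split=> // z /vlineP[a ->] Zau; rewrite linearZ /= lu.
  rewrite /GRing.scale /= mulr1 leNgt; apply/negP => a0.
  have /(ZZ _ _) : 0 < (- a)^-1 by rewrite invr_gt0 oppr_gt0.
  by move=> /(_ _ Zau); rewrite scalerA invrN mulNr mulVf ?lt_eqF // scaleN1r.
elim: k => [|k IH] U uU dU [l [lu lZ]].
  exists l; split=> // z; apply: lZ; suff -> : U = fullv by exact: memvf.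
  by apply/eqP; rewrite -(geq_leqif (dimv_leqif_eq (subvf U))) -subn_eq0 dU.
have /subvPn[q _ qU] : ~~ ({:V} <= U)%VS.
  by apply/negP => /dimvS; rewrite -subn_eq0 dU.
have [f fq fU] := functional_notin qU.
(* An element [s + q] of [Z] forces the value at [q] to be at least [- l s]; elements [s' - q] of
   [Z] give upper bounds. The value chosen at [q] is the supremum of the lower bounds. *)
pose S := [set - l s | s in [set s | s \in U /\ Z (s + q)]].
have Sle s' : s' \in U -> Z (s' - q) -> ubound S (l s').
  move=> s'U Zs' _ [s [sU Zs] <-].
  suff : 0 <= l (s + s') by rewrite linearD /= -lerBlDl sub0r.
  apply: lZ; first exact: memvD.
  by rewrite -[s + s']addr0 -(subrr q) addrACA; exact: ZD.
have [t1 t10 Z1] := bnd q; have [t2 t20 Z2] := bnd (- q).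
have S0 : S !=set0 by exists (- l (t1 *: u)), (t1 *: u) => //; rewrite /= memvZ.
have Ss : has_sup S by split=> //; exists (l (t2 *: u)); apply: Sle;
  rewrite ?memvZ.
apply: (IH (U + <[q]>)%VS); first by rewrite -[u]addr0 memv_add ?mem0v.
  rewrite dimv_disjoint_sum; last first.
    apply/eqP; rewrite -subv0; apply/subvP => z; rewrite memv_cap => /andP[zU].
    move=> /vlineP[a za]; move: zU; rewrite za rpredZeq (negPf qU) orbF memv0 =>
      /eqP->.
    by rewrite scale0r eqxx.
  by rewrite dim_vline (_ : q != 0) ?addn1 ?subnS ?dU //;
    apply: contraNneq qU => ->; exact: mem0v.
exists (l + (sup S - l q) *: f).
have E z a : z \in U -> (l + (sup S - l q) *: f) (z + a *: q) = l z + a * sup S.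
  move=> zU; rewrite add_lfunE scale_lfunE.
  have -> : f (z + a *: q) = a.
    by rewrite linearD linearZ /= fU // fq /GRing.scale /= mulr1 add0r.
  by rewrite linearD linearZ /= /GRing.scale /=; ring.
split.
  by rewrite -[u in LHS]addr0 -(scale0r q) E // lu mul0r addr0.
move=> _ /memv_addP[s sU [_ /vlineP[a ->] ->]] Zz; rewrite E //.
have [a0|a0|a0] := ltgtP a 0; last first.
- by rewrite a0 mul0r addr0; apply: lZ; rewrite // -[s]addr0 -(scale0r q) -a0.
- have Zs : S (- l (a^-1 *: s)).
    exists (a^-1 *: s) => //; split; first exact: memvZ.
    have := ZZ a^-1 _ _ Zz; rewrite invr_gt0 scalerDr scalerA mulVf ?gt_eqF //.
    by rewrite scale1r; exact.
  have := sup_upper_bound Ss Zs; rewrite linearZ /= /GRing.scale /= => h.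
  have : a * - (a^-1 * l s) <= a * sup S by rewrite ler_wpM2l // ltW.
  by rewrite mulrN mulVKf ?gt_eqF //; lra.
- have na : 0 < - a by rewrite oppr_gt0.
  have Zs : Z ((- a)^-1 *: s - q).
    have := ZZ (- a)^-1 _ _ Zz; rewrite invr_gt0 scalerDr scalerA invrN mulNr.
    by rewrite mulVf ?lt_eqF // scaleN1r; exact.
  have := ge_sup S0 (Sle _ (memvZ _ sU) Zs);
    rewrite linearZ /= /GRing.scale /= => h.
  have : - a * sup S <= - a * ((- a)^-1 * l s) by rewrite ler_wpM2l // ltW.
  by rewrite mulVKf ?gt_eqF //; lra.
Qed.

End HahnBanach.

(** * Contraction on cones invariant under reflections *)

Lemma free_spanning_subset {K : fieldType} {V : vectType K} (D : set V) :
  exists (m : nat) (X : m.-tuple V),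
    [/\ free X, forall i : 'I_m, D X`_i & forall d, D d -> d \in <<X>>%VS].
Proof.
suff ext k : forall m (X : m.-tuple V), free X -> (forall i : 'I_m, D X`_i) ->
    (\dim {:V} - m = k)%N ->
    exists (m : nat) (X : m.-tuple V),
    [/\ free X, forall i : 'I_m, D X`_i & forall d, D d -> d \in <<X>>%VS].
  by apply: (ext _ 0 [tuple]) => //; [exact: nil_free|case].
elim: k => [|k IH] m X fX DX dX.
  exists m, X; split=> // d _; suff -> : <<X>>%VS = fullv by exact: memvf.
  apply/eqP; rewrite -(geq_leqif (dimv_leqif_eq (subvf _))) -subn_eq0.
  by rewrite (eqP fX) size_tuple dX.
have [h|/existsNP[d /not_implyP[Dd /negP dX']]] :=
    pselect (forall d, D d -> d \in <<X>>%VS).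
  by exists m, X.
apply: (IH m.+1 [tuple of d :: X]); first by rewrite /= free_cons dX'.
  by case=> -[|i] //= im; exact: (DX (Ordinal (im : i < m)%N)).
by rewrite subnS dX.
Qed.

(** Each of the m! terms of the Leibniz expansion has one factor bounded by [e] and the others
    bounded by 1. *)
Lemma det_lt1 {R : realDomainType} (m : nat) (M : 'M[R]_m) (e : R) :
  (0 < m)%N -> e <= 1 -> e * (m`!)%:R < 1 -> (forall i j, `|M i j| <= e) ->
  (\det M) ^+ 2 < 1.
Proof.
move=> m0 e1 em Me; rewrite -real_normK ?num_real // expr_lt1 //.
have e0 : 0 <= e by apply: le_trans (Me (Ordinal m0) (Ordinal m0)).
apply: le_lt_trans em; apply: le_trans (ler_norm_sum _ _ _) _.
have -> : (m`!)%:R = \sum_(s : 'S_m) (1 : R).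
  by rewrite sumr_const -card_Sn cardE.
rewrite mulr_sumr.
apply: ler_sum => s _; rewrite mulr1 normrM normrX normrN1 expr1n mul1r
  normr_prod.
rewrite (bigD1 (Ordinal m0)) //= -[leRHS]mulr1 ler_pM //.
  by rewrite prodr_ge0.
by apply: numdomain.Num.Theory.prodr_ile1 => i _;
  rewrite normr_ge0 (le_trans (Me _ _)).
Qed.

Section ReflectionInvariantCone.
Context {R : realType} {n : nat} (B : 'M[R]_n) (u : 'cV[R]_n).
Hypotheses (B2 : forall i, B i i = 2) (u0 : forall i, 0 < u i 0)
  (Bu0 : forall i, 0 < (B *m u) i 0).

(** On columns this is the reflection of [x] to [x - (B *m x) j 0 *: delta_mx j 0]; right
    multiplication of rows by it is the dual action, under which [D] is invariant. *)
Let refl j : 'M[R]_n := 1%:M - delta_mx j 0 *m row j B.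

Let reflE (j : 'I_n) (c : 'rV[R]_n) : c *m refl j = c - c 0 j *: row j B.
Proof.
rewrite mulmxBr mulmx1 mulmxA -colE (mx11_scalar (col j c)) mul_scalar_mx.
by rewrite mxE.
Qed.

Let reflK (j : 'I_n) : refl j *m refl j = 1%:M.
Proof.
rewrite /refl; set P := delta_mx j 0 *m row j B.
have PP : P *m P = P + P.
  rewrite mulmxA -[P *m _]mulmxA -colE (mx11_scalar (col j _)) !mxE B2.
  by rewrite mul_mx_scalar -scalemxAl scaler_nat mulr2n.
by rewrite mulmxBl !mulmxBr !mulmx1 !mul1mx PP opprB addrK subrK.
Qed.

(* If [- u] is not in [Z], the dual cone [D] of [Z] is nonzero and invariant.
   Products of reflections have determinant 1 or -1 on the span of [D], but some
   of them contract the height [ht] on [D] by an arbitrarily small factor. *)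
Lemma reflection_invariant_cone (Z : set 'cV[R]_n) : convex_cone Z ->
    (forall x, (forall i, 0 <= (B *m x) i 0) -> Z x) ->
    (forall x j, Z x -> Z (x - (B *m x) j 0 *: delta_mx j 0)) ->
  Z (- u).
Proof.
move=> Zc Zdom Zrefl; apply: contrapT => Zu.
have ou (x : 'cV[R]_n) : exists2 t, 0 < t & Z (u + t *: x).
  have [t t0 ht] := small_perturbation (fun i => (B *m u) i 0)
    (fun i => (B *m x) i 0).
  exists t => //; apply: Zdom => i; rewrite mulmxDr -scalemxAr mxE
    [X in _ + X]mxE ltW //.
  by apply: ht; rewrite ?lexx ?ltW.
have uZ : Z u by have [t _] := ou 0; rewrite scaler0 addr0.
have [l [lu lZ]] := convex_cone_separation Zc ou Zu.
pose D : set 'rV[R]_n := [set c | forall x, Z x -> 0 <= (c *m x) 0 0].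
pose ht (c : 'rV[R]_n) := (c *m u) 0 0.
have Drefl c j : D c -> D (c *m refl j).
  move=> Dc x Zx; have := Dc _ (Zrefl x j Zx).
  rewrite reflE mulmxBl mulmxBr -scalemxAr -scalemxAl -colE -row_mul.
  by rewrite !mxE mulrC.
have ht0 c : D c -> 0 <= ht c by exact.
have htE (c : 'rV[R]_n) t x : (c *m (u + t *: x)) 0 0 = ht c + t * (c *m x) 0 0.
  by rewrite mulmxDr -scalemxAr mxE [X in _ + X]mxE.
(* Since [u] is interior to [Z], the height controls every linear form on the dual cone. *)
have htZ (w : 'cV[R]_n) :
    exists2 K, 0 < K & forall c, D c -> `|(c *m w) 0 0| <= K * ht c.
  have [t t0 Zt] := ou w; have [s s0] := ou (- w);
    rewrite scalerN -scaleNr => Zs.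
  have [ti si] : 0 < t^-1 /\ 0 < s^-1 by rewrite !invr_gt0.
  exists (t^-1 + s^-1); first exact: addr_gt0.
  move=> c Dc; have h1 := Dc _ Zt; have h2 := Dc _ Zs; have h := ht0 _ Dc.
  rewrite !htE in h1 h2; move: ((c *m w) 0 0) h1 h2 => y h1 h2.
  have {}h1 : 0 <= t^-1 * ht c + y by rewrite -(pmulr_rge0 _ t0) mulrDr mulVKf
    ?gt_eqF.
  have {}h2 : 0 <= s^-1 * ht c - y.
    by rewrite -(pmulr_rge0 _ s0) mulrBr mulVKf ?gt_eqF // -mulNr.
  have := mulr_ge0 (ltW ti) h; have := mulr_ge0 (ltW si) h.
  by rewrite ler_norml mulrDl; move=> *; apply/andP; split; lra.
have [m [X [fX DX spanX]]] := free_spanning_subset D.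
have m0 : (0 < m)%N.
  rewrite lt0n; apply/eqP => m0.
  pose c : 'rV[R]_n := \row_j l (delta_mx j 0).
  have cE x : (c *m x) 0 0 = l x.
    rewrite [x in RHS]matrix_sum_delta linear_sum mxE; apply: eq_bigr => j _.
    by rewrite big_ord1 linearZ /= !mxE mulrC.
  have : c \in <<X>>%VS by apply: spanX => x Zx; rewrite cE; exact: lZ.
  move: (X); rewrite m0 => X0; rewrite [X0]tuple0 span_nil memv0 => /eqP c0.
  by move: lu; rewrite -cE c0 mul0mx mxE => /eqP; rewrite eq_sym oner_eq0.
(* The matrix, in the basis [X] of the span of [D], of right multiplication by [G]; it is meaningful
   when [G] preserves [D]. *)
pose mat (G : 'M[R]_n) : 'M[R]_m := \matrix_(i, k) coord X k (X`_i *m G).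
have matM G T : (forall c, D c -> D (c *m G)) -> mat (G *m T) = mat G *m mat T.
  move=> DG; apply/matrixP => i k; rewrite !mxE mulmxA.
  rewrite [X in coord _ _ (X *m T)](coord_span (spanX _ (DG _ (DX i)))).
  rewrite mulmx_suml linear_sum; apply: eq_bigr => p _.
  by rewrite -scalemxAl linearZ !mxE.
have mat1 : mat 1%:M = 1%:M.
  by apply/matrixP => i k; rewrite !mxE mulmx1 coord_free // eq_sym.
have n0 : (0 < n)%N.
  rewrite lt0n; apply/eqP => n0; apply: Zu; apply: Zdom => i.
  by have : (i < 0)%N by rewrite -[X in (_ < X)%N]n0.
(* The height of [c] is a sum of the [c 0 j] with weights [u j 0] of total [S], so some [c 0 j] is
   at least [ht c / S]. Reflecting at that [j] lowers the height by [c 0 j] times [(B *m u) j 0],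
   which is at least [d^-1]. The summand [S^-1] in [d] ensures 0 <= q. *)
have [q /andP[q0 q1] hq] : exists2 q, 0 <= q < 1 & forall c, D c ->
    exists j, ht (c *m refl j) <= q * ht c.
  pose S := \sum_j u j 0.
  have S0 : 0 < S.
    by rewrite /S (bigD1 (Ordinal n0)) //= ltr_pwDl // sumr_ge0 // => j _;
      exact: ltW.
  pose d := \sum_i ((B *m u) i 0)^-1 + S^-1.
  have dS : S^-1 <= d.
    by rewrite lerDr sumr_ge0 // => i _; rewrite invr_ge0 ltW.
  have d0 : 0 < d by rewrite (lt_le_trans _ dS) ?invr_gt0.
  have dB j : d^-1 <= (B *m u) j 0.
    rewrite -[leRHS]invrK lef_pV2 ?posrE ?invr_gt0 // /d (bigD1 j) //= -addrA
      lerDl.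
    by rewrite addr_ge0 ?sumr_ge0 // => [i _|]; rewrite invr_ge0 ltW.
  exists (1 - (S * d)^-1).
    have : 1 <= S * d by rewrite -ler_pdivrMl // mulr1.
    move=> Sd; have Sd0 : 0 < S * d by rewrite mulr_gt0.
    have : 0 < (S * d)^-1 by rewrite invr_gt0.
    have : (S * d)^-1 <= 1 by rewrite invf_le1.
    by move=> *; apply/andP; split; lra.
  move=> c Dc; have [j cj] : exists j, ht c / S <= c 0 j.
    apply: contrapT => /forallNP hc.
    have : ht c < ht c / S * S.
      rewrite {1}/ht mxE /S mulr_sumr; apply: ltr_sum => [|j _].
        by apply/hasP; exists (Ordinal n0); rewrite ?mem_index_enum.
      by rewrite ltr_pM2r // ltNge; apply/negP; exact: hc.
    by rewrite divfK ?gt_eqF // ltxx.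
  exists j; rewrite reflE /ht mulmxBl -scalemxAl -row_mul mxE [X in _ + X]mxE.
  rewrite [X in _ - X]mxE [X in _ * X]mxE -/(ht c) mulrBl mul1r lerB //.
  rewrite invfM mulrC mulrA ler_pM // ?mulr_ge0 ?invr_ge0 ?ht0 // ?ltW //.
(* Heights are nonnegative on [D], so contracting the height of this sum contracts that of every
   basis vector. *)
pose f := \sum_(i < m) X`_i.
have desc k : exists G : 'M[R]_n, [/\ forall c, D c -> D (c *m G),
    \det (mat G) ^+ 2 = 1 & ht (f *m G) <= q ^+ k * ht f].
  elim: k => [|k [G [DG detG htG]]].
    by exists 1%:M; split=> [c||]; rewrite ?mulmx1 ?mat1 ?det1 ?expr1n ?mul1r.
  have Df : D (f *m G).
    move=> x Zx; rewrite !mulmx_suml summxE sumr_ge0 // => i _.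
    exact: (DG _ (DX i)).
  have [j hj] := hq _ Df.
  exists (G *m refl j); split.
  - by move=> c Dc; rewrite mulmxA; apply/Drefl/DG.
  - rewrite matM // det_mulmx exprMn detG mul1r expr2 -det_mulmx -matM ?reflK
    ?mat1 ?det1 //.
    by move=> c; exact: Drefl.
  - rewrite mulmxA (le_trans hj) // exprS -mulrA ler_wpM2l //.
have hK (p : 'I_m) : exists2 K, 0 < K & forall c,
  D c -> `|coord X p c| <= K * ht c.
  have [K K0 hK] := htZ (\col_k coord X p (delta_mx 0 k)).
  exists K => // c Dc; apply: le_trans (hK c Dc); rewrite mxE.
  rewrite {1}(row_sum_delta c) linear_sum /= le_eqVlt; apply/orP; left;
    apply/eqP.
  by congr `| _ |; apply: eq_bigr => k _; rewrite linearZ mxE.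
have /choice[K KP] : forall p, exists K, 0 < K /\ forall c,
  D c -> `|coord X p c| <= K * ht c.
  by move=> p; have [K ? ?] := hK p; exists K.
pose KK := 1 + \sum_p K p.
have KK0 : 0 < KK by rewrite ltr_pwDl // sumr_ge0 // => p _;
  exact: ltW (KP p).1.
have KKp p : K p <= KK.
  rewrite /KK (bigD1 p) //= addrCA lerDl addr_ge0 // sumr_ge0 // => i _.
  exact: ltW (KP i).1.
(* Chosen so that e <= 1 and e m! < 1, as [det_lt1] demands. *)
pose e : R := ((m`!)%:R + 1)^-1.
have e0 : 0 < e by rewrite invr_gt0 ltr_wpDl.
have [k hk] : exists k, KK * (q ^+ k * ht f) <= e.
  have hf : 0 <= ht f.
    by rewrite /ht mulmx_suml summxE sumr_ge0 // => i _; exact: DX.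
  have hf1 : 0 < KK * (ht f + 1) by rewrite mulr_gt0 // ltr_wpDl.
  have /cvgrPdist_lt /(_ (e / (KK * (ht f + 1))) (divr_gt0 e0 hf1)) : q ^+ k
    @[k --> \oo] --> (0 : R).
    by apply: cvg_expr; rewrite ger0_norm.
  move=> [N _ /(_ N (leqnn N))] /=.
  rewrite sub0r normrN ger0_norm ?exprn_ge0 //.
  rewrite ltr_pdivlMr // => hN; exists N.
  apply: le_trans (ltW hN); rewrite mulrCA ler_wpM2l ?exprn_ge0 //.
  by rewrite ler_wpM2l ?(ltW KK0) // lerDl.
have [G [DG detG htG]] := desc k.
suff : \det (mat G) ^+ 2 < 1 by rewrite detG ltxx.
apply: (@det_lt1 _ _ _ e) => //.
- by rewrite invf_le1 ?lerDr // ltr_wpDl.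
- by rewrite mulrC ltr_pdivrMr ?mul1r ?ltrDl // ltr_wpDl.
- move=> i p; rewrite mxE; apply: le_trans ((KP p).2 _ (DG _ (DX i))) _.
  apply: le_trans hk; apply: ler_pM => //; first exact: ltW (KP p).1.
    exact/ht0/DG/DX.
  apply: le_trans htG; rewrite /ht !mulmx_suml summxE (bigD1 i) //= lerDl.
  by rewrite sumr_ge0 // => j _; apply/ht0/DG/DX.
Qed.
End ReflectionInvariantCone.

(** * Relative interiors and faces of convex cones *)

Section ConeRelativeInterior.
Context {R : realType} {V : vectType R}.
Implicit Types (K F G : set V).

Lemma convex_cone_sum K (I : Type) (r : seq I) (P : pred I) (c : I -> R)
  (x : I -> V) :
  convex_cone K -> K 0 -> (forall i, P i -> 0 <= c i) ->
    (forall i, P i -> K (x i)) ->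
  K (\sum_(i <- r | P i) c i *: x i).
Proof.
move=> [KD KZ] K0 c0 Kx; apply: (big_ind K) => // i Pi.
have := c0 i Pi; rewrite le_eqVlt => /predU1P[<-|ci]; first by rewrite scale0r.
by apply: KZ => //; exact: Kx.
Qed.

(** For the converse, take a basis [X] of the span made of elements of [K], and subtract from [x] a
    small multiple [t] of its sum without leaving [K]. A point of the span near [x] has coordinates
    relative to [x] of size at most [t], so it is recovered by adding nonnegative multiples of the
    basis vectors. *)
Lemma relint_convex_cone K : convex_cone K -> K 0 ->
  relint K = [set x | K x /\ forall y, K y -> exists2 t : R,
    0 < t & K (x - t *: y)].
Proof.
move=> Kc K0; apply/seteqP; split=> x /= [Kx].
  move=> /nbhs_ballP[e /= e0 he]; split=> // y Ky.
  have [t t0 ht] := small_perturbation (fun=> e) (fun j => - `|v2r y 0 j|).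
  exists t => //; rewrite -[x - _]v2rK; apply: he.
    split=> // i j; rewrite linearB linearZ /= -ball_normE /= !mxE opprB addrC
      subrK.
    rewrite normrM gtr0_norm // ord1 -subr_gt0 -mulrN.
    by apply: ht; rewrite ?lexx ?ltW.
  (* The point 0 of the cone takes the coefficient [t], bringing the total to 1. *)
  rewrite v2rK; exists 3%N, (fun i => nth 0 [:: x; y; 0] i),
    (fun i => nth 0 [:: 1; - t; t] i).
  split.
  - by case=> -[|[|[|]]].
  - by rewrite !big_ord_recl big_ord0 /=; ring.
  - by rewrite !big_ord_recl big_ord0 /= scale1r scaler0 !addr0 scaleNr.
move=> hx; split=> //.
have [m [X [fX KX spanX]]] := free_spanning_subset K.
have [t t0 Kt] : exists2 t : R, 0 < t & K (x - t *: \sum_(i < m) 1 *: X`_i).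
  by apply: hx; apply: convex_cone_sum.
pose N := 1 + \sum_(i < m) \sum_j `|coord X i (r2v (delta_mx 0 j))|.
have N0 : 0 < N by rewrite ltr_pwDl // sumr_ge0 // => i _; exact: sumr_ge0.
apply/nbhs_ballP; exists (t / N); first by rewrite /= divr_gt0.
move=> p xp [k [y [c [Ky c1 pE]]]].
have pX : r2v p - x \in <<X>>%VS.
  apply: memvB; last exact: spanX.
  by rewrite pE memv_suml // => i _; exact/memvZ/spanX.
have cb (i : 'I_m) : `|coord X i (r2v p - x)| <= t.
  rewrite -[x]v2rK -linearB [_ - v2r x]row_sum_delta !linear_sum /=.
  apply: le_trans (ler_norm_sum _ _ _) _.
  apply: (@le_trans _ _ (\sum_j t / N * `|coord X i (r2v (delta_mx 0 j))|)).
    apply: ler_sum => j _; rewrite !linearZ /= normrM ler_wpM2r //.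
    by have [_ /(_ 0 j)] := xp; rewrite -ball_normE /= distrC !mxE => /ltW.
  rewrite -mulr_sumr mulrAC ler_pdivrMr // ler_pM2l // /N (bigD1 i) //= addrCA
    lerDl.
  by rewrite addr_ge0 // sumr_ge0 // => ? _; exact: sumr_ge0.
have -> : r2v p = (x - t *: \sum_(i < m) 1 *: X`_i) +
    \sum_(i < m) (t + coord X i (r2v p - x)) *: X`_i.
  have {1}-> : r2v p = x + (r2v p - x) by rewrite addrC subrK.
  rewrite -addrA; congr (_ + _); rewrite {1}(coord_span pX) scaler_sumr -sumrN
    -big_split /=.
  by apply: eq_bigr => i _; rewrite scale1r scalerDl addrA addNr add0r.
apply: (proj1 Kc) => //; apply: convex_cone_sum => // i _.
by have := cb i; rewrite ler_norml => /andP[]; lra.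
Qed.

Lemma relint_convex_cone_nonempty K : convex_cone K -> K 0 -> relint K !=set0.
Proof.
move=> Kc K0; have [m [X [fX KX spanX]]] := free_spanning_subset K.
exists (\sum_(i < m) 1 *: X`_i); rewrite relint_convex_cone //; split.
  exact: convex_cone_sum.
move=> y Ky; have [t t0 ht] :=
  small_perturbation (fun=> 1) (fun i : 'I_m => - coord X i y).
exists t => //; rewrite {1}(coord_span (spanX _ Ky)) scaler_sumr -sumrN
  -big_split /=.
rewrite (eq_bigr (fun i : 'I_m => (1 - t * coord X i y) *: X`_i)) => [|i _].
  apply: convex_cone_sum => // i _; rewrite -mulrN; apply/ltW/ht => //.
  by rewrite lexx ltW.
by rewrite scalerBl scalerA.
Qed.

Lemma face_0 K F : K 0 -> Fa K F -> F 0.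
Proof.
move=> K0 [[[_ FZ] FK Ff] [x Fx]]; apply: contrapT => F0.
by have [_] := Ff 0 x (conj K0 F0) (FK _ Fx); rewrite add0r.
Qed.

(** If [y] in [F] were outside [G], so would be [t *: y], and then also [x], its sum with
    [x - t *: y]. Hence faces whose relative interiors meet are equal. *)
Lemma relint_face_sub K F G x : K 0 -> Fa K F -> Fa K G -> relint F x -> G x ->
  F `<=` G.
Proof.
move=> K0 FF [[[GD GZ] GK Gf] _] xF Gx y Fy.
have [[Fc FK _] _] := FF.
move: xF; rewrite relint_convex_cone //; last exact: face_0 FF.
move=> [Fx /(_ y Fy)[t t0 Ft]]; apply: contrapT => nGy.
have [|_] := Gf (t *: y) (x - t *: y) _ (FK _ Ft); last by rewrite addrC subrK.
split; first by apply: FK; exact: (proj2 Fc).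
move=> /(GZ t^-1 _); rewrite invr_gt0 scalerA mulVf ?gt_eqF // scale1r.
by move=> /(_ t0).
Qed.

End ConeRelativeInterior.

(** * Types of subsets of a generalized Cartan matrix *)

Section Types.
Context {R : realType} {n : nat} (A : 'M[R]_n).
Hypotheses (A2 : forall i, A i i = 2) (Ale0 : forall i j, i != j -> A i j <= 0)
  (A0C : forall i j, A i j = 0 -> A j i = 0).
Implicit Types J K P Q : {set 'I_n}.

(** On connected sets this is the negation of [finite_type]; in general it characterizes special
    sets. The weights multiply rows because they become the coefficients of a combination of the
    [h j]. *)
Definition infinite_type J : Prop :=
  exists c : 'I_n -> R, (forall j, j \in J -> 0 < c j) /\
    (forall i, i \in J -> \sum_(j in J) c j * A j i <= 0).

Lemma separatedP J K :
  reflect (forall i j, i \in J -> j \in K -> A i j = 0) (Defs.separated A J K).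
Proof.
apply: (iffP forall_inP) => [h i j iJ jK|h i iJ].
  by have /forall_inP/(_ j jK)/eqP := h i iJ.
by apply/forall_inP => j jK; rewrite h.
Qed.

Lemma connected_subset K J1 J2 : connected_set A K ->
  K \subset (J1 :|: J2)%SET ->
  [disjoint J1 & J2]%B -> Defs.separated A J1 J2 ->
    (K \subset J1) || (K \subset J2).
Proof.
move=> /andP[_ /existsPn cK] KJ dJ sJ; have := cK (K :&: J1)%SET.
move=> /existsPn/(_ (K :&: J2)%SET); rewrite -finset.setIUr (finset.setIidPl KJ)
  eqxx /=.
have -> : Defs.separated A (K :&: J1)%SET (K :&: J2)%SET.
  apply/separatedP => i j; rewrite !inE => /andP[_ iJ] /andP[_ jJ].
  exact: (separatedP _ _ sJ).
have -> : [disjoint (K :&: J1)%SET & (K :&: J2)%SET]%B.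
  apply: disjointWl (finset.subsetIr _ _) _;
    apply: disjointWr (finset.subsetIr _ _) _.
  exact: dJ.
rewrite !andbT negb_and !negbK => /orP[|] /eqP h; apply/orP; [right|left].
  by rewrite -(finset.setIidPl KJ) finset.setIUr h finset.set0U finset.subsetIr.
by rewrite -(finset.setIidPl KJ) finset.setIUr h finset.setU0 finset.subsetIr.
Qed.

Lemma connectedU K1 K2 i j : connected_set A K1 -> connected_set A K2 ->
  i \in K1 -> j \in K2 -> A i j != 0 -> connected_set A (K1 :|: K2)%SET.
Proof.
move=> c1 c2 iK jK aij; apply/andP; split.
  by apply/finset.set0Pn; exists i; rewrite inE iK.
apply/existsPn => J1; apply/existsPn => J2; apply/negP.
move=> /and5P[J10 J20 dJ /eqP KJ sJ].
have h1 : (K1 \subset J1) || (K1 \subset J2).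
  by apply: connected_subset => //; rewrite -KJ finset.subsetUl.
have h2 : (K2 \subset J1) || (K2 \subset J2).
  by apply: connected_subset => //; rewrite -KJ finset.subsetUr.
have dis x : x \in J1 -> x \in J2 -> False.
  by move=> x1 x2; move/finset.disjoint_setI0: dJ => /finset.setP/(_ x);
    rewrite !inE x1 x2.
case/orP: h1 => h1; case/orP: h2 => h2.
- case/finset.set0Pn: J20 => x xJ; apply: (dis x) => //.
  have : x \in (J1 :|: J2)%SET by rewrite inE xJ orbT.
  by rewrite -KJ inE => /orP[/(fintype.subsetP h1)|/(fintype.subsetP h2)].
- case/eqP: aij; apply: (separatedP _ _ sJ);
  [exact: (fintype.subsetP h1)|exact: (fintype.subsetP h2)].
- case/eqP: aij; apply/A0C/(separatedP _ _ sJ);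
  [exact: (fintype.subsetP h2)|exact: (fintype.subsetP h1)].
- case/finset.set0Pn: J10 => x xJ; apply: (dis x) => //.
  have : x \in (J1 :|: J2)%SET by rewrite inE xJ.
  by rewrite -KJ inE => /orP[/(fintype.subsetP h1)|/(fintype.subsetP h2)].
Qed.

Lemma component_sub J K : connected_component_of A J K -> K \subset J.
Proof. by move=> /maxsetp/andP[]. Qed.

Lemma component_cover J i : i \in J -> exists2 K,
  connected_component_of A J K & i \in K.
Proof.
move=> iJ; have ci : connected_set A [set i]%SET && ([set i]%SET \subset J);
  last first.
  by have [K mK iK] := @maxset_exists _
    (fun K => connected_set A K && (K \subset J)) _ ci; exists K => //;
    rewrite -finset.sub1set.
rewrite finset.sub1set iJ andbT; apply/andP; split.
  by apply/finset.set0Pn; exists i; rewrite inE.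
apply/existsPn => J1; apply/existsPn => J2; apply/negP.
move=> /and5P[/finset.set0Pn[x xJ] /finset.set0Pn[y yJ] dJ /eqP KJ _].
have xi : x = i by apply/finset.set1P; rewrite KJ inE xJ.
have yi : y = i by apply/finset.set1P; rewrite KJ inE yJ orbT.
by move/finset.disjoint_setI0: dJ => /finset.setP/(_ i);
  rewrite !inE -{1}xi -yi xJ yJ.
Qed.

Lemma component_separated J K1 K2 i j : connected_component_of A J K1 ->
  connected_component_of A J K2 -> K1 != K2 -> i \in K1 -> j \in K2 ->
    A i j = 0.
Proof.
move=> m1 m2 K12 iK jK; apply/eqP; apply: contraR K12 => aij.
have /andP[c1 s1] := maxsetp m1; have /andP[c2 s2] := maxsetp m2.
have cU : connected_set A (K1 :|: K2)%SET && ((K1 :|: K2)%SET \subset J).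
  by rewrite (connectedU c1 c2 iK jK aij) finset.subUset s1 s2.
have /finset.setP e1 := maxsetsup m1 cU (finset.subsetUl _ _).
have /finset.setP e2 := maxsetsup m2 cU (finset.subsetUr _ _).
by apply/eqP/finset.setP => x; rewrite -e1 -e2.
Qed.

Lemma component_inj J K1 K2 i : connected_component_of A J K1 ->
  connected_component_of A J K2 -> i \in K1 -> i \in K2 -> K1 = K2.
Proof.
move=> m1 m2 i1 i2; apply/eqP/negP => /negP K12.
by have := component_separated m1 m2 K12 i1 i2; rewrite A2 => /eqP;
  rewrite pnatr_eq0.
Qed.

Lemma sum_subset (K U : {set 'I_n}) (f : 'I_n -> R) : K \subset U ->
  (forall j, j \in U -> j \notin K -> f j = 0) ->
  \sum_(j in U) f j = \sum_(j in K) f j.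
Proof.
move=> KU f0; rewrite (bigID (mem K)) /= [X in _ + X]big1 ?addr0 =>
  [|j /andP[]]; last exact: f0.
by apply: eq_bigl => j; case: (boolP (j \in K)) => jK;
  rewrite ?andbF // (fintype.subsetP KU).
Qed.

Lemma finite_type_subset J K : K \subset J -> finite_type A J ->
  finite_type A K.
Proof.
move=> KJ [u [u0 Au]]; exists u; split=> [j jK|i iK].
  by apply: u0; exact: (fintype.subsetP KJ).
have iJ := fintype.subsetP KJ _ iK; apply: lt_le_trans (Au i iJ) _.
rewrite (bigID (mem K)) /=.
have -> : \sum_(j in J | j \in K) A i j * u j = \sum_(j in K) A i j * u j.
  by apply: eq_bigl => j; case: (boolP (j \in K)) => jK;
    rewrite ?andbF // (fintype.subsetP KJ).
rewrite gerDl sumr_le0 // => j /andP[jJ jK]; rewrite mulr_le0_ge0 //;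
  last exact/ltW/u0.
by apply: Ale0; apply: contraNneq jK => <-.
Qed.

Section Gluing.
Variables (J : {set 'I_n}) (Q : pred {set 'I_n}).
Let U := (\bigcup_(K : {set 'I_n} | connected_component_of A J K && Q K) K)%SET.

Lemma bigcup_componentP i :
  reflect (exists K, [/\ connected_component_of A J K, Q K & i \in K])
    (i \in U).
Proof.
apply: (iffP finset.bigcupP) => [[K /andP[? ?] ?]|[K [? ? ?]]]; exists K => //.
by apply/andP.
Qed.

(** The component of [i] in [J], with a dummy value outside [J]. Vectors found on the components are
    glued as [u (comp j) j]; cross terms vanish since distinct components are separated. *)
Let comp i := odflt finset.set0
  [pick K | connected_component_of A J K && (i \in K)].

Let compE i K : connected_component_of A J K -> i \in K -> comp i = K.
Proof.
move=> cK iK; rewrite /comp; case: pickP => [K' /andP[cK' iK']|/(_ K)] /=.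
  exact: (component_inj cK' cK iK' iK).
by rewrite cK iK.
Qed.

Let sum_component (f : 'I_n -> R) i K : connected_component_of A J K -> Q K ->
  i \in K ->
  (forall j, A i j = 0 -> f j = 0) -> \sum_(j in U) f j = \sum_(j in K) f j.
Proof.
move=> cK QK iK f0; apply: sum_subset.
  by apply/fintype.subsetP => j jK; apply/bigcup_componentP; exists K.
move=> j /bigcup_componentP[K' [cK' QK' jK']] jK; apply: f0.
by apply: (component_separated cK cK' _ iK jK'); apply: contraNneq jK => ->.
Qed.

Lemma finite_type_bigcup :
  (forall K, connected_component_of A J K -> Q K -> finite_type A K) ->
    finite_type A U.
Proof.
move=> h; have /choice[u uP] : forall K, exists u : 'I_n -> R,
    connected_component_of A J K -> Q K -> (forall j, j \in K -> 0 < u j) /\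
    (forall i, i \in K -> 0 < \sum_(j in K) A i j * u j).
  move=> K; have [[cK QK]|nQ] := pselect (connected_component_of A J K /\ Q K).
    by have [u uK] := h K cK QK; exists u.
  by exists (fun=> 0) => cK QK; case: nQ.
exists (fun j => u (comp j) j); split=> i /bigcup_componentP[K [cK QK iK]].
  by rewrite (compE cK iK); exact: (uP K cK QK).1.
rewrite (sum_component cK QK iK); last by move=> j ->; rewrite mul0r.
rewrite (eq_bigr (fun j => A i j * u K j)) => [|j jK];
  first exact: (uP K cK QK).2.
by rewrite (compE cK jK).
Qed.

Lemma infinite_type_bigcup :
  (forall K, connected_component_of A J K -> Q K -> infinite_type K) ->
    infinite_type U.
Proof.
move=> h; have /choice[u uP] : forall K, exists u : 'I_n -> R,
    connected_component_of A J K -> Q K -> (forall j, j \in K -> 0 < u j) /\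
    (forall i, i \in K -> \sum_(j in K) u j * A j i <= 0).
  move=> K; have [[cK QK]|nQ] := pselect (connected_component_of A J K /\ Q K).
    by have [u uK] := h K cK QK; exists u.
  by exists (fun=> 0) => cK QK; case: nQ.
exists (fun j => u (comp j) j); split=> i /bigcup_componentP[K [cK QK iK]].
  by rewrite (compE cK iK); exact: (uP K cK QK).1.
rewrite (sum_component cK QK iK); last by move=> j /A0C ->; rewrite mulr0.
rewrite (eq_bigr (fun j => u K j * A j i)) => [|j jK];
  first exact: (uP K cK QK).2.
by rewrite (compE cK jK).
Qed.

End Gluing.

(* A maximal support of such a [c] is all of [K]: an index outside the support
   but linked to it could be given a small positive weight. *)
Lemma infinite_type_support K (c : 'I_n -> R) : connected_set A K ->
  (forall j, 0 <= c j) -> (forall j, j \notin K -> c j = 0) ->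
    (exists j, 0 < c j) ->
  (forall i, i \in K -> \sum_(j in K) c j * A j i <= 0) -> infinite_type K.
Proof.
move=> cK; pose z (c : 'I_n -> R) : {set 'I_n} := [set j in K | c j == 0]%SET.
move nE : #|z c| => m; elim: m c nE => [|m IH] c nE c0 cn [j cj] cA.
  exists c; split=> // i iK; rewrite lt0r c0 andbT.
  apply/negP => ci; have := cards0_eq nE => /finset.setP/(_ i).
  by rewrite !inE iK ci.
have jK : j \in K by apply: contraTT cj => /cn ->; rewrite ltxx.
have [i [k [iK ci kK ck ki]]] : exists i k,
    [/\ i \in K, 0 < c i, k \in K, c k = 0 & A i k != 0].
  apply: contrapT => h; case/andP: cK => _ /existsPn/(_ (K :\: z c)%SET).
  move/existsPn/(_ (z c)); case/negP; apply/and5P; split.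
  - by apply/finset.set0Pn; exists j; rewrite !inE jK andbT gt_eqF.
  - by rewrite -card_gt0 nE.
  - by rewrite -finset.setI_eq0; apply/eqP/finset.setP => x; rewrite !inE;
    case: (x \in K) (c x == 0) => -[].
  - by apply/eqP/finset.setP => x; rewrite !inE;
    case: (x \in K) (c x == 0) => -[].
  - apply/separatedP => x y; rewrite !inE => /andP[h1 xK] /andP[yK /eqP cy].
    apply/eqP; apply: contrapT => /negP Axy; apply: h; exists x, y; split=> //.
    by rewrite lt0r c0 andbT; apply: contraNneq h1 => ->; rewrite xK eqxx.
have ik : i != k by apply: contraTneq ci => ->; rewrite ck ltxx.
pose s := \sum_(j in K) c j * A j k.
have s0 : s < 0.
  rewrite /s (bigD1 i) //= ltr_nwDl //.
    by rewrite pmulr_rlt0 // lt_neqAle ki Ale0.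
  apply: sumr_le0 => x /andP[xK xi].
  have [->|xk] := eqVneq x k; first by rewrite ck mul0r.
  by rewrite mulr_ge0_le0 ?Ale0.
(* As [A k k] = 2, the weight - s / 2 turns the inequality at [k] into an equality; it can only
   lower the other sums. *)
pose c' x := if x == k then - s / 2 else c x.
have s2 : 0 < - s / 2 by rewrite divr_gt0 // oppr_gt0.
have c'E x : \sum_(j in K) c' j * A j x = \sum_(j in K) c j * A j x + - s / 2 *
  A k x.
  rewrite (bigD1 k) //= {1}/c' eqxx addrC; congr (_ + _).
  rewrite [RHS](bigD1 k) //= ck mul0r add0r;
    apply: eq_bigr => y /andP[_ /negPf yk].
  by rewrite /c' yk.
apply: (IH c').
- have : k \in z c by rewrite inE kK ck eqxx.
  move=> kz; move: nE; rewrite (cardsD1 k) kz => -[<-]; apply: eq_card => x.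
  rewrite !inE /c'; have [->|//] := eqVneq x k.
  by rewrite (gt_eqF s2) andbF.
- by move=> x; rewrite /c'; case: eqP => // _; exact: ltW.
- by move=> x xK; rewrite /c' (cn x xK); case: eqVneq => // xk; move: xK;
  rewrite xk kK.
- by exists k; rewrite /c' eqxx.
- move=> x xK; rewrite c'E; have [->|xk] := eqVneq x k.
    by rewrite A2 divfK ?pnatr_eq0 // -/s subrr.
  have := cA x xK; have : - s / 2 * A k x <= 0.
    by rewrite mulr_ge0_le0 ?(ltW s2) // Ale0 // eq_sym.
  by lra.
Qed.

(** Gordan's alternative is applied to the rows of [A] on [K] together with the coordinate forms. A
    positive functional would exhibit finite type; the other case gives c A + d = 0 with c, d >= 0,
    so c A <= 0. The unit vectors at indices outside [K] pad the family and receive coefficient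
    0. *)
Lemma connected_infinite_type K :
  connected_set A K -> ~ finite_type A K -> infinite_type K.
Proof.
move=> cK nK.
pose x (i : 'I_n + 'I_n) : 'rV[R]_n := match i with
  | inl i => if i \in K then \sum_(j in K) A i j *: delta_mx 0 j else delta_mx 0
    i
  | inr i => delta_mx 0 i end.
have [[l l0]|[c [c0 [i ci] cE]]] := gordan x.
  case: nK; exists (fun j => l (delta_mx 0 j)); split=> [j _|i iK].
    exact: (l0 (inr j)).
  have := l0 (inl i); rewrite /= iK linear_sum.
  by rewrite (eq_bigr (fun j => A i j * l (delta_mx 0 j))) // => j _;
    rewrite linearZ.
have xE k : \sum_i c (inl i) * x (inl i) 0 k + c (inr k) = 0.
  have := congr1 (fun y : 'rV[R]_n => y 0 k) cE.
  rewrite big_sumType /= mxE !summxE [X in _ = X]mxE => h; rewrite -[RHS]h;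
    congr (_ + _).
    by apply: eq_bigr => j _; rewrite [RHS]mxE.
  rewrite (bigD1 k) //= big1 => [|j jk]; first by rewrite !mxE !eqxx mulr1
    addr0.
  by rewrite !mxE eqxx eq_sym (negPf jk) mulr0.
have xK k : k \notin K -> c (inl k) = 0 /\ c (inr k) = 0.
  move=> kK; have := xE k.
  rewrite (bigD1 k) //= (negPf kK) mxE !eqxx mulr1 big1 => [|j jk].
    have := c0 (inl k); have := c0 (inr k); move=> *; split; lra.
  case: ifP => jK; last by rewrite mxE eqxx eq_sym (negPf jk) mulr0.
  rewrite summxE big1 ?mulr0 // => p pK; rewrite !mxE eqxx (_ : k == p = false)
    ?mulr0 //.
  by apply/negP => /eqP kp; move: kK; rewrite kp pK.
have xK' k : k \in K -> \sum_(i in K) c (inl i) * A i k + c (inr k) = 0.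
  move=> kK; rewrite -[RHS](xE k); congr (_ + _).
  rewrite [RHS](bigID (mem K)) /= [X in _ = _ + X]big1 ?addr0 => [|j jK];
    last first.
    by rewrite (xK j jK).1 mul0r.
  apply: eq_bigr => j jK; rewrite jK summxE (bigD1 k) //= !mxE !eqxx mulr1 big1
    ?addr0 //.
  by move=> p /andP[_ pk]; rewrite !mxE eqxx eq_sym (negPf pk) mulr0.
apply: (@infinite_type_support _ (fun i => c (inl i)) cK) => //.
- by move=> j /xK[].
- apply: contrapT => /forallNP h.
  have h0 j : c (inl j) = 0.
    by apply/eqP/negP => /negP hj; apply: (h j); rewrite lt0r hj c0.
  case: i ci => i; first by rewrite h0 ltxx.
  have [iK|/xK[_ ->]] := boolP (i \in K); last by rewrite ltxx.
  have := xK' i iK; rewrite big1 ?add0r => [->|j _]; first by rewrite ltxx.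
  by rewrite h0 mul0r.
- by move=> k /xK'; have := c0 (inr k); lra.
Qed.

Lemma finite_type_fin_part J : finite_type A (fin_part A J).
Proof. by apply: finite_type_bigcup => K _ /asboolP. Qed.

Lemma infinite_type_inf_part J : infinite_type (inf_part A J).
Proof.
apply: infinite_type_bigcup => K /maxsetp/andP[cK _] /negP nK.
by apply: connected_infinite_type => // fK; apply/nK/asboolP.
Qed.

Lemma fin_inf_partU J : J = (fin_part A J :|: inf_part A J)%SET.
Proof.
apply/finset.setP => i; rewrite inE; apply/idP/orP.
  move=> /component_cover[K cK iK].
  have [fK|nK] := boolP `[< finite_type A K >]; [left|right];
    by apply/bigcup_componentP; exists K.
by case=> /bigcup_componentP[K [cK _ iK]];
  exact: (fintype.subsetP (component_sub cK)).
Qed.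

Lemma fin_inf_part_separated J i j : i \in fin_part A J -> j \in inf_part A J ->
  A i j = 0.
Proof.
move=> /bigcup_componentP[K [cK fK iK]] /bigcup_componentP[K' [cK' fK' jK']].
apply: (component_separated cK cK' _ iK jK').
by apply: contraTneq fK => ->.
Qed.

(** If [P] meets [Q], sum c_j A_ji u_i over j in the intersection and i in [P]. Summing over i first
    gives a positive number. Summing over j first gives nonpositive ones: for i in [Q] the missing
    indices of [Q] lie in [S] and contribute 0, and for i outside [Q] only off-diagonal entries
    occur. *)
Lemma infinite_type_disjoint P Q S : finite_type A P -> infinite_type Q ->
  Q \subset (P :|: S)%SET -> (forall i j, i \in P -> j \in S -> A i j = 0) ->
  Q \subset S.
Proof.
move=> [u [u0 Pu]] [c [c0 cQ]] QPS sep.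
have [/eqP PQ|/finset.set0Pn[k kPQ]] := boolP ((P :&: Q)%SET == finset.set0).
  apply/fintype.subsetP => i iQ; have := fintype.subsetP QPS i iQ;
    rewrite inE => /orP[iP|//].
  by have /finset.setP/(_ i) := PQ; rewrite !inE iP iQ.
have : 0 < \sum_(j in (P :&: Q)%SET) \sum_(i in P) c j * A j i * u i.
  rewrite (bigD1 k) //= ltr_pwDl //; last apply: sumr_ge0 => j /andP[jPQ _];
    rewrite -?(eq_bigr _ (fun i _ => mulrA (c _) (A _ _) (u i))) -?mulr_sumr.
    by move: kPQ; rewrite inE => /andP[kP kQ]; rewrite mulr_gt0 ?c0 ?Pu.
  by move: jPQ; rewrite inE => /andP[jP jQ]; rewrite ltW // mulr_gt0 ?c0 ?Pu.
rewrite exchange_big /= ltNge; case/negP; apply: sumr_le0 => i iP.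
rewrite -mulr_suml mulr_le0_ge0 //; last exact/ltW/u0.
have [iQ|iQ] := boolP (i \in Q).
  rewrite -(sum_subset (U := Q)) ?finset.subsetIr ?cQ // => j jQ.
  rewrite inE jQ andbT => jP; have := fintype.subsetP QPS j jQ;
    rewrite inE (negPf jP) /= => jS.
  by rewrite (A0C (sep i j iP jS)) mulr0.
apply: sumr_le0 => j; rewrite inE => /andP[jP jQ];
  rewrite mulr_ge0_le0 ?(ltW (c0 j jQ)) //.
by apply: Ale0; apply: contraNneq iQ => <-.
Qed.

(** For the converse, [fin_part] has finite type and is separated from [inf_part], so the preceding
    lemma confines [J] to [inf_part]. *)
Lemma special_infinite_type J : special A J <-> infinite_type J.
Proof.
split=> [<-|iJ]; first exact: infinite_type_inf_part.
have := @infinite_type_disjoint (fin_part A J) J (inf_part A J).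
rewrite -fin_inf_partU => /(_ (finite_type_fin_part J) iJ (fintype.subxx _)).
move=> /(_ (@fin_inf_part_separated J)) h.
by apply/eqP; rewrite finset.eqEsubset h andbT {2}[J]fin_inf_partU
  finset.subsetUr.
Qed.

Lemma fin_part_id J : fin_part A J = J <-> finite_type A J.
Proof.
split=> [<-|fJ]; first exact: finite_type_fin_part.
apply/eqP; rewrite finset.eqEsubset {2}[J]fin_inf_partU finset.subsetUl /=.
apply/fintype.subsetP => i /component_cover[K cK iK]; apply/bigcup_componentP;
  exists K.
split=> //; apply/asboolP; exact: finite_type_subset (component_sub cK) fJ.
Qed.

End Types.

(** * Chambers and the Tits cone *)

Section Reflections.
Context {R : realType} {V : vectType R} {n : nat}.
Local Notation Vd := 'Hom(V, R^o).
Variables (h : 'I_n -> V) (alpha : 'I_n -> Vd).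
Implicit Types (i j k : 'I_n) (l m : Vd) (s t : seq 'I_n).

Definition simple_refl i l : Vd := l - (l (h i) : R) *: alpha i.

(* The elements of the Coxeter group are represented by words in the simple
   reflections. *)
Definition word_act s l : Vd := foldr simple_refl l s.

Lemma simple_reflE i l g : simple_refl i l g = l g - l (h i) * alpha i g :> R.
Proof. by rewrite add_lfunE opp_lfunE scale_lfunE. Qed.

Lemma simple_refl_is_linear i : linear (simple_refl i).
Proof.
move=> a l m; rewrite /simple_refl add_lfunE scale_lfunE scalerDl scalerBr
  scalerA.
by rewrite opprD addrACA.
Qed.

Lemma word_act_is_linear s : linear (word_act s).
Proof.
by elim: s => [//|i s IH] a l m; rewrite /= IH simple_refl_is_linear.
Qed.

Lemma word_actD s l m : word_act s (l + m) = word_act s l + word_act s m.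
Proof. by have := word_act_is_linear s 1 l m; rewrite !scale1r. Qed.

Lemma word_act0 s : word_act s 0 = 0.
Proof. by apply: (addrI (word_act s 0)); rewrite -word_actD !addr0. Qed.

Lemma word_actZ s a l : word_act s (a *: l) = a *: word_act s l.
Proof. by have := word_act_is_linear s a l 0; rewrite word_act0 !addr0. Qed.

Lemma word_act_cat s t l : word_act (s ++ t) l = word_act s (word_act t l).
Proof. exact: foldr_cat. Qed.

Hypothesis alpha2 : forall i, alpha i (h i) = 2.

Lemma simple_refl_h i l : simple_refl i l (h i) = - l (h i) :> R.
Proof. by rewrite simple_reflE alpha2; ring. Qed.

Lemma simple_refl_id i l : l (h i) = 0 -> simple_refl i l = l.
Proof. by rewrite /simple_refl => ->; rewrite scale0r subr0. Qed.

Lemma simple_reflK i : involutive (simple_refl i).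
Proof.
move=> l; rewrite {1}/simple_refl simple_refl_h scaleNr opprK.
by rewrite /simple_refl subrK.
Qed.

Lemma word_act_revK s : cancel (word_act s) (word_act (rev s)).
Proof.
elim: s => [//|i s IH] l; rewrite rev_cons -cats1 word_act_cat /= simple_reflK.
exact: IH.
Qed.

Lemma word_actK s : cancel (word_act (rev s)) (word_act s).
Proof. by move=> l; rewrite -{1}[s]revK word_act_revK. Qed.

Definition strictly_dominant l := forall i, 0 < l (h i).
Definition dominant l := forall i, 0 <= l (h i).

(** * Sides of reflection hyperplanes and the exchange condition *)

Hypothesis chamber : exists l, strictly_dominant l.
Hypothesis wall : forall i, exists2 l : Vd, l (h i) = 0 & forall j,
  j != i -> 0 < l (h j).
Hypothesis word_act_free : forall s l,
  strictly_dominant l -> strictly_dominant (word_act s l) -> word_act s =1 id.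

(** Geometric form of the condition that multiplying by the reflection [i] on the left shortens
    [s]. *)
Definition negative_side s i := forall l,
  strictly_dominant l -> word_act s l (h i) < 0.

(* A chamber does not meet the hyperplane of a reflection: the reflection
   would have a fixed point in it. *)
Lemma word_act_neq0 s i l : strictly_dominant l -> word_act s l (h i) != 0.
Proof.
move=> ld; apply/eqP => z.
have E : word_act (rev s ++ i :: s) =1 id.
  apply: (word_act_free ld).
  by rewrite word_act_cat /= simple_refl_id ?word_act_revK.
have := simple_refl_h i (alpha i).
have -> : simple_refl i (alpha i) = alpha i.
  have := E (word_act (rev s) (alpha i)); rewrite word_act_cat /= word_actK.
  by move=> /(congr1 (word_act s)); rewrite !word_actK.
by rewrite alpha2; lra.
Qed.

(** Two points of the chamber with values of opposite sign have a positive combination with value 0,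
    which [word_act_neq0] excludes. *)
Lemma word_act_sign s i :
  negative_side s i \/ (forall l, strictly_dominant l ->
    0 < word_act s l (h i)).
Proof.
have [[l [ld lpos]]|/forallNP hn] :=
  pselect (exists l, strictly_dominant l /\ 0 < word_act s l (h i)); last first.
  left=> l ld; rewrite lt_neqAle word_act_neq0 // leNgt.
  by apply/negP => l0; apply: (hn l).
right=> m md; rewrite lt0r word_act_neq0 //= leNgt; apply/negP => m0.
pose p := - (word_act s m (h i) : R) *: l + (word_act s l (h i) : R) *: m.
have pd : strictly_dominant p.
  move=> j; rewrite add_lfunE !scale_lfunE /GRing.scale /= addr_gt0 ?mulr_gt0
    //.
  by rewrite oppr_gt0.
have /eqP[] := word_act_neq0 s i pd.
rewrite word_actD !word_actZ add_lfunE !scale_lfunE /GRing.scale /=.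
by rewrite mulNr mulrC addNr.
Qed.

Lemma dominant_perturbation l m : dominant l -> strictly_dominant m ->
  forall e : R, 0 < e -> strictly_dominant (l + e *: m).
Proof.
move=> ld md e e0 j; rewrite add_lfunE scale_lfunE; apply: ltr_wpDl;
  first exact: ld.
by rewrite /GRing.scale /= mulr_gt0.
Qed.

Lemma ge0_perturbation (a b : R) : (forall e, 0 < e -> 0 <= a + e * b) ->
  0 <= a.
Proof.
move=> hab; rewrite leNgt; apply/negP => a0.
have [t t0 ht] := small_perturbation (fun _ : 'I_1 => - a) (fun=> - b).
have := ht t ord0; rewrite lexx oppr_gt0 ltW //= => /(_ isT a0).
by have := hab t t0; rewrite mulrN -opprD oppr_gt0 ltNge => ->.
Qed.

Lemma word_act_dominant s i l : ~ negative_side s i -> dominant l ->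
  0 <= word_act s l (h i).
Proof.
case: (word_act_sign s i) => // pos _ ld; have [m md] := chamber.
apply: (@ge0_perturbation _ (word_act s m (h i))) => e e0.
have := pos _ (dominant_perturbation ld md e0).
by rewrite word_actD word_actZ add_lfunE scale_lfunE => /ltW.
Qed.

Lemma neg_dominant s i l : negative_side s i -> dominant l ->
  word_act s l (h i) <= 0.
Proof.
move=> ns ld; have [m md] := chamber; rewrite -oppr_ge0.
apply: (@ge0_perturbation _ (- word_act s m (h i))) => e e0.
have := ns _ (dominant_perturbation ld md e0).
rewrite word_actD word_actZ add_lfunE scale_lfunE /GRing.scale /=.
by rewrite mulrN -opprD oppr_ge0 => /ltW.
Qed.

(* The chamber [s C] lies on the positive side of the hyperplane of [i], and
   [s j C] on the negative side; they share the wall [s q], so that this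
   hyperplane is that of [s j s^-1]; near [s q] both reflections exchange the
   two sides, so they agree by freeness. *)
Lemma wall_crossing s i j : ~ negative_side s i ->
  negative_side (rcons s j) i ->
  forall l, simple_refl i (word_act s l) = word_act s (simple_refl j l).
Proof.
move=> ps nsj; have [m md] := chamber; have [q q0 qp] := wall j.
have pos l : strictly_dominant l -> 0 < word_act s l (h i).
  by case: (word_act_sign s i) => [/ps//|]; exact.
have wallE l : (forall k, k != j -> 0 < l (h k)) -> l (h j) = 0 ->
  word_act s l (h i) = 0.
  move=> lp lj; have ld : dominant l.
    by move=> k; have [->|/lp/ltW//] := eqVneq k j; rewrite lj.
  apply/eqP; rewrite eq_le (word_act_dominant ps ld) andbT.
  have := neg_dominant nsj ld; rewrite -cats1 word_act_cat /=.
  by rewrite simple_refl_id.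
(* [q] is interior to its wall, so vanishing on the wall extends to the whole hyperplane of [j]. *)
have hypE l : l (h j) = 0 -> word_act s l (h i) = 0.
  move=> lj.
  have [t t0 ht] := small_perturbation (fun k => q (h k) : R)
    (fun k => l (h k)).
  have := wallE (q + t *: l).
  rewrite word_actD word_actZ add_lfunE scale_lfunE wallE // add0r.
  move=> /(_ _ _)/eqP; rewrite mulf_eq0 gt_eqF //= => H; apply/eqP/H.
    by move=> k kj; rewrite add_lfunE scale_lfunE; apply: ht;
      rewrite ?lexx ?ltW ?qp.
  by rewrite add_lfunE scale_lfunE q0 lj /GRing.scale /= mulr0 addr0.
pose kap : R := word_act s m (h i) / m (h j).
have kap0 : 0 < kap by rewrite divr_gt0 ?pos.
have kapE l : word_act s l (h i) = kap * l (h j) :> R.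
  have := hypE (l - (l (h j) / m (h j) : R) *: m).
  rewrite add_lfunE opp_lfunE scale_lfunE /GRing.scale /= divfK ?gt_eqF ?md //.
  rewrite subrr -scaleNr => /(_ erefl).
  rewrite word_actD word_actZ add_lfunE scale_lfunE /GRing.scale /= /kap.
  by move=> /eqP; rewrite addr_eq0 mulNr opprK => /eqP ->; ring.
(* [w] fixes [q] and sends [m] to the positive side of [j]; hence [q + t *: m] and its image both
   lie in the chamber for small [t]. *)
pose w := j :: rev s ++ i :: s.
have wE l : word_act w l = simple_refl j
  (word_act (rev s) (simple_refl i (word_act s l))).
  by rewrite /w /= word_act_cat.
have wq : word_act w q = q.
  by rewrite wE [simple_refl i _]simple_refl_id ?kapE ?q0 ?mulr0 //
    word_act_revK simple_refl_id.
have wm : 0 < word_act w m (h j).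
  rewrite wE simple_refl_h oppr_gt0 -(pmulr_rlt0 _ kap0) -kapE word_actK.
  by rewrite simple_refl_h oppr_lt0 pos.
have [t t0 ht] := small_perturbation (fun k => q (h k) : R)
  (fun k => word_act w m (h k)).
have w1 : word_act w =1 id.
  apply: (@word_act_free _ (q + t *: m)) => k;
    rewrite ?word_actD ?word_actZ ?wq;
    rewrite add_lfunE scale_lfunE.
    have [->|kj] := eqVneq k j; first by rewrite q0 add0r mulr_gt0.
    by rewrite addr_gt0 ?qp // mulr_gt0.
  have [->|kj] := eqVneq k j; first by rewrite q0 add0r mulr_gt0.
  by apply: ht; rewrite ?lexx ?ltW ?qp.
move=> l; have := w1 l; rewrite wE => /(congr1 (simple_refl j));
  rewrite simple_reflK.
by move=> /(congr1 (word_act s)); rewrite word_actK.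
Qed.

(** Prefixes of [s] lead from the chamber to its image; the letter at which the hyperplane of [i] is
    crossed can be deleted, by [wall_crossing]. *)
Lemma exchange s i : negative_side s i ->
  exists2 t, (size t < size s)%N & forall l,
    simple_refl i (word_act s l) = word_act t l.
Proof.
elim/last_ind: s => [|s j IH] ns.
  by have [l ld] := chamber; have := ns l ld; have := ld i; rewrite /=; lra.
have [/IH[t ts tE]|ps] := pselect (negative_side s i).
  exists (rcons t j); first by rewrite !size_rcons.
  by move=> l; rewrite -!cats1 !word_act_cat tE.
exists s; first by rewrite size_rcons.
by move=> l; rewrite -cats1 word_act_cat /= (wall_crossing ps ns) simple_reflK.
Qed.

(** Replaces induction on reduced expressions: each reflection is applied from its positive side.
    The predicate concerns maps rather than words, because [exchange] changes the word and keeps its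
    action. When no side is negative, freeness makes the action trivial. *)
Lemma word_act_ind (P : (Vd -> Vd) -> Prop) : P id ->
    (forall i t, ~ negative_side t i -> P (word_act t) ->
      P (fun l => simple_refl i (word_act t l))) ->
  forall s, P (word_act s).
Proof.
move=> P1 PS s; have [k] := ubnP (size s); elim: k s => // k IH s sk.
have [[i ns]|/forallNP pn] := pselect (exists i, negative_side s i); last first.
  suff -> : word_act s = id by [].
  have [l ld] := chamber; apply/funext; apply: (@word_act_free _ l) => // i.
  by case: (word_act_sign s i) => [/pn//|]; exact.
have [t ts tE] := exchange ns.
suff -> : word_act s = (fun l => simple_refl i (word_act t l)).
  apply: PS; last by apply: IH; exact: leq_trans ts sk.
  have [l ld] := chamber => /(_ l ld); rewrite -tE simple_refl_h.
  by have := ns l ld; lra.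
by apply/funext => l; rewrite -tE simple_reflK.
Qed.

(** A reflection applied from its positive side and ending in the closed chamber meets the value 0,
    so it acts trivially. *)
Lemma dominant_orbit s l : dominant l -> dominant (word_act s l) ->
  word_act s l = l.
Proof.
move: l; apply: (word_act_ind (P := fun f => forall l,
  dominant l -> dominant (f l) -> f l = l)).
  by [].
move=> i t nt IH l ld d.
have z : word_act t l (h i) = 0.
  apply/eqP; rewrite eq_le word_act_dominant // andbT.
  by have := d i; rewrite simple_refl_h oppr_ge0.
by move: d; rewrite simple_refl_id //; exact: IH.
Qed.

(** * Convexity of the Tits cone *)

Definition Tits l := exists s m, dominant m /\ l = word_act s m.

Lemma Tits_word_act s l : Tits l -> Tits (word_act s l).
Proof. by move=> [t [m [md ->]]]; exists (s ++ t), m; rewrite word_act_cat. Qed.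

Lemma dominantZ (a : R) l : 0 <= a -> dominant l -> dominant (a *: l).
Proof. by move=> a0 ld i; rewrite scale_lfunE mulr_ge0. Qed.

(* The segment from [l] to [s m] leaves the closed chamber through a wall [i]
   that separates the chamber from its image under [s]; the rest of it is the
   reflection of a segment ending in the image under a shorter word. *)
Lemma Tits_add_dominant s l m : dominant l -> dominant m ->
  Tits (l + word_act s m).
Proof.
have [k] := ubnP (size s); elim: k s l m => // k IH s l m sk ld md.
have [d|/existsNP[i0 /negP]] := pselect (dominant (l + word_act s m)).
  by exists [::], (l + word_act s m).
rewrite -ltNge => i0n.
(* The parameter at which the ray from [l] in direction [word_act s m] meets the hyperplane of [i];
   the smallest one among the violated inequalities marks the exit from the closed chamber. *)
pose r i : R := l (h i) / - word_act s m (h i).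
pose bad i := (l + word_act s m) (h i) < 0.
have [i bi imin] : exists2 i, bad i & forall j, bad j -> r i <= r j.
  by exists [arg min_(i < i0 | bad i) r i]%O; case: arg_minP.
have smi : word_act s m (h i) < 0.
  by move: bi; rewrite /bad add_lfunE; have := ld i; lra.
have ri1 : r i < 1.
  rewrite ltr_pdivrMr ?oppr_gt0 // mul1r.
  by move: bi; rewrite /bad add_lfunE; lra.
have ri0 : 0 <= r i by rewrite divr_ge0 // oppr_ge0 ltW.
pose p := l + r i *: word_act s m.
have pd : dominant p.
  move=> j; rewrite add_lfunE scale_lfunE /GRing.scale /=.
  have [sj|sj] := leP 0 (word_act s m (h j)); first by apply: addr_ge0;
    [exact: ld|exact: mulr_ge0].
  have nsj : 0 < - word_act s m (h j) by rewrite oppr_gt0.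
  suff : r i * - word_act s m (h j) <= l (h j) by rewrite mulrN; lra.
  rewrite -ler_pdivlMr //; have [bj|gj] := boolP (bad j); first exact: imin.
  apply: le_trans (ltW ri1) _; rewrite ler_pdivlMr // mul1r.
  by move: gj; rewrite /bad -leNgt add_lfunE; lra.
have pi0 : p (h i) = 0.
  rewrite add_lfunE scale_lfunE /GRing.scale /= /r invrN mulrN mulNr divfK
    ?subrr //.
  by rewrite lt_eqF.
have nsi : negative_side s i.
  by apply: contrapT => /word_act_dominant/(_ md); have := smi; lra.
have [t ts tE] := exchange nsi.
have -> : l + word_act s m = word_act [:: i] (p + word_act t ((1 - r i) *: m)).
  rewrite word_actD /= simple_refl_id // word_actZ -tE.
  have -> : simple_refl i ((1 - r i) *: simple_refl i (word_act s m)) =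
      (1 - r i) *: word_act s m.
    by rewrite -[LHS]/(word_act [:: i] _) word_actZ /= simple_reflK.
  by rewrite /p -addrA -scalerDl addrCA subrr addr0 scale1r.
apply: Tits_word_act; apply: IH => //; first exact: leq_trans ts sk.
by apply: dominantZ => //; rewrite subr_ge0 ltW.
Qed.

Lemma Tits_convex_cone : convex_cone Tits.
Proof.
split=> [_ _ [s [l [ld ->]]] [t [m [md ->]]]|a _ a0 [s [l [ld ->]]]].
  have -> : word_act s l + word_act t m = word_act s
    (l + word_act (rev s ++ t) m).
    by rewrite word_actD word_act_cat word_actK.
  exact/Tits_word_act/Tits_add_dominant.
exists s, (a *: l); rewrite word_actZ; split=> //; apply: dominantZ => //.
exact: ltW.
Qed.

(** * The faces R(Theta) *)

Local Notation A := (cartan_mx h alpha).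

Lemma cartanE i j : A i j = alpha j (h i).
Proof. by rewrite mxE. Qed.

Lemma cartan2 i : A i i = 2.
Proof. by rewrite cartanE. Qed.

Lemma wall_dominant i l : l (h i) = 0 -> (forall j, j != i -> 0 < l (h j)) ->
  dominant l.
Proof. by move=> l0 lp j; have [->|/lp/ltW//] := eqVneq j i; rewrite l0. Qed.

(** A point of wall [j], fixed by the reflection [j], shows that the reflected chamber lies on the
    positive side of [i]; a point of wall [i] then reveals the sign of the entry. *)
Lemma cartan_le0 i j : i != j -> A i j <= 0.
Proof.
move=> ij; have [q q0 qp] := wall j; have [p p0 pp] := wall i.
have nn : ~ negative_side [:: j] i.
  move=> /neg_dominant/(_ (wall_dominant q0 qp)); rewrite /= simple_refl_id //.
  by rewrite leNgt qp.
have := word_act_dominant nn (wall_dominant p0 pp).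
rewrite /= simple_reflE p0 sub0r oppr_ge0 pmulr_rle0 ?cartanE //.
by rewrite pp // eq_sym.
Qed.

(** If a_ij = 0 and a_ji < 0, then after the word [[:: i; j]] the value at [h j] is - l(h_j) - a_ji
    l(h_i): positive on wall [j] and negative on wall [i], although an image of the chamber lies on
    one side. *)
Lemma cartan_eq0C i j : A i j = 0 -> A j i = 0.
Proof.
have [->|ij] := eqVneq i j; first by [].
rewrite !cartanE => aij; apply/eqP; rewrite eq_le -cartanE cartan_le0 1?eq_sym
  //=.
rewrite leNgt; apply/negP; rewrite cartanE => aji.
have [q q0 qp] := wall j; have [p p0 pp] := wall i.
have E l : word_act [:: i; j] l (h j) = - l (h j) - l (h i) * alpha i (h j) :>
  R.
  by rewrite /= simple_reflE simple_refl_h simple_reflE aij mulr0 subr0.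
have nn : ~ negative_side [:: i; j] j.
  move=> /neg_dominant/(_ (wall_dominant q0 qp));
    rewrite E q0 oppr0 sub0r oppr_le0.
  by rewrite leNgt pmulr_rlt0 ?aji ?qp.
have := word_act_dominant nn (wall_dominant p0 pp);
  rewrite E p0 mul0r subr0 oppr_ge0.
by rewrite leNgt pp // eq_sym.
Qed.

Lemma antidominant_le b : (forall i, alpha i b <= 0) ->
  forall s l, dominant l -> l b <= word_act s l b.
Proof.
move=> ab s; apply: (word_act_ind
  (P := fun f => forall l, dominant l -> l b <= f l b)).
  by [].
move=> i t nt IH l ld; rewrite simple_reflE; apply: le_trans (IH l ld) _.
by rewrite lerDl oppr_ge0 mulr_ge0_le0 //; exact: word_act_dominant.
Qed.

Definition Rset (T : {set 'I_n}) : set Vd :=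
  [set x | exists2 s, all [in perp A T] s &
             exists2 l, closed_face h T l & x = word_act s l].

Lemma closed_face_dominant T l : closed_face h T l -> dominant l.
Proof. by move=> lT i; have := lT i; case: ifP => // _ ->. Qed.

Lemma closed_face0 T l i : closed_face h T l -> i \in T -> l (h i) = 0.
Proof. by move=> lT iT; have := lT i; rewrite iT. Qed.

Lemma open_face_closed T l : open_face h T l -> closed_face h T l.
Proof. by move=> lT i; have := lT i; case: ifP => // _ /ltW. Qed.

Lemma closed_face_Rset T l : closed_face h T l -> Rset T l.
Proof. by move=> lT; exists [::] => //; exists l. Qed.

Lemma in_perp T i j : i \in perp A T -> j \in T -> A i j = 0.
Proof. by rewrite inE => /forall_inP hi /hi/eqP. Qed.

Lemma word_act_perp T s l j : all [in perp A T] s -> j \in T ->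
  word_act s l (h j) = l (h j).
Proof.
move=> sT jT; elim: s sT => //= i s IH /andP[iT /IH <-].
by rewrite simple_reflE -cartanE (cartan_eq0C (in_perp iT jT)) mulr0 subr0.
Qed.

Lemma Rset_word_act T s x : all [in perp A T] s -> Rset T x ->
  Rset T (word_act s x).
Proof.
move=> sT [t tT [l lT ->]]; exists (s ++ t); first by rewrite all_cat sT.
by exists l => //; rewrite word_act_cat.
Qed.

Lemma Rset_Tits T : Rset T `<=` Tits.
Proof. by move=> _ [s _ [l /closed_face_dominant ld ->]]; exists s, l. Qed.

Lemma Rset0 T x j : Rset T x -> j \in T -> x (h j) = 0.
Proof.
by move=> [s sT [l lT ->]] jT; rewrite (word_act_perp _ sT jT)
  (closed_face0 lT).
Qed.

Lemma infinite_type_functional T : infinite_type A T ->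
  exists2 c : 'I_n -> R, forall j, j \in T -> 0 < c j &
    forall b, b = \sum_(j in T) c j *: h j ->
      (forall x, Tits x -> 0 <= x b) /\
        (forall x, Rset T x <-> Tits x /\ x b = 0).
Proof.
move=> [c [c0 cT]]; exists c => // b bE.
have lbE (l : Vd) : l b = \sum_(j in T) c j * l (h j).
  by rewrite bE linear_sum; apply: eq_bigr => j _; rewrite linearZ.
have ab i : alpha i b <= 0.
  rewrite lbE; have [iT|iT] := boolP (i \in T).
    have := cT i iT; rewrite (eq_bigr (fun j => c j * alpha i (h j))) // => j _.
    by rewrite cartanE.
  apply: sumr_le0 => j jT; rewrite mulr_ge0_le0 ?(ltW (c0 j jT)) // -cartanE.
  by apply: cartan_le0; apply: contraNneq iT => <-.
have lb0 l : dominant l -> 0 <= l b.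
  by move=> ld; rewrite lbE sumr_ge0 // => j jT;
    rewrite mulr_ge0 ?(ltW (c0 j jT)).
have Tb x : Tits x -> 0 <= x b.
  by move=> [s [l [ld ->]]]; apply: le_trans (lb0 l ld) _;
    exact: antidominant_le.
split=> // x; split=> [xR|].
  split; first exact: Rset_Tits xR.
  by rewrite lbE big1 // => j jT; rewrite (Rset0 xR jT) mulr0.
move=> [[s [l [ld ->]]] lb]; move: l ld lb.
apply: (word_act_ind (P := fun f => forall l,
  dominant l -> f l b = 0 -> Rset T (f l))).
  move=> l ld lb; apply: closed_face_Rset => i; case: ifP => iT; last exact: ld.
  move: lb; rewrite lbE => /eqP; rewrite psumr_eq0; last first.
    by move=> j jT; rewrite mulr_ge0 ?(ltW (c0 j jT)) //; exact: ld.
  move=> /allP/(_ i (mem_index_enum _)); rewrite iT mulf_eq0 gt_eqF ?c0 //=.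
  by move=> /eqP.
move=> i t nt IH l ld; rewrite simple_reflE => E.
(* Two nonnegative terms add up to 0. Thus either the reflection fixes the point, or [alpha i b] =
   0; in that case [i] is not in [T], so [alpha i b] is a sum of nonpositive terms with positive
   weights, and each entry vanishes. *)
have ti := word_act_dominant nt ld.
have tb : 0 <= word_act t l b by apply: Tb; exists t, l.
have tia : 0 <= - (word_act t l (h i) * alpha i b) by rewrite oppr_ge0
  mulr_ge0_le0.
have tR : Rset T (word_act t l) by apply: IH => //; lra.
have [z|nz] := eqVneq (word_act t l (h i)) 0; first by rewrite simple_refl_id.
have aib : alpha i b = 0.
  apply/eqP; have : word_act t l (h i) * alpha i b == 0 by apply/eqP; lra.
  by rewrite mulf_eq0 (negPf nz).
suff iT : i \in perp A T.
  by apply: (Rset_word_act (s := [:: i])) => //=; rewrite iT.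
have iT' : i \notin T.
  by apply: contra nz => iT; rewrite (Rset0 tR iT).
rewrite inE; apply/forall_inP => j jT; apply/eqP/cartan_eq0C; rewrite cartanE.
move: aib; rewrite lbE => /eqP; rewrite -oppr_eq0 -sumrN psumr_eq0; last first.
  move=> k kT; rewrite -mulrN mulr_ge0 ?(ltW (c0 k kT)) // oppr_ge0 -cartanE.
  by apply: cartan_le0; apply: contraNneq iT' => <-.
move=> /allP/(_ j (mem_index_enum _)); rewrite jT oppr_eq0 mulf_eq0 gt_eqF ?c0
  //=.
by move=> /eqP.
Qed.

Lemma Rset_convex_cone T : infinite_type A T -> convex_cone (Rset T).
Proof.
move=> /infinite_type_functional[c _ /(_ _ erefl)[_ RE]].
have [TD TZ] := Tits_convex_cone; split=> [x y|t x t0]; rewrite !RE.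
  by move=> [xT xb] [yT yb]; split; [exact: TD|rewrite add_lfunE xb yb addr0].
by move=> [xT xb]; split; [exact: TZ|rewrite scale_lfunE xb scaler0].
Qed.

Lemma dominant0 : dominant 0.
Proof. by move=> i; rewrite zero_lfunE. Qed.

Lemma Tits0 : Tits 0.
Proof. by exists [::], 0; split=> //; exact: dominant0. Qed.

Lemma Rset_0 T : Rset T 0.
Proof. by apply: closed_face_Rset => i; rewrite zero_lfunE; case: ifP. Qed.

Lemma Rset_face T : infinite_type A T -> Fa Tits (Rset T).
Proof.
move=> iT; split; last by exists 0; exact: Rset_0.
split; [exact: Rset_convex_cone|exact: Rset_Tits|move=> x y].
have [c _ /(_ _ erefl)[Tb RE]] := infinite_type_functional iT.
move=> [xT xR] yT; split; first by have [TD _] := Tits_convex_cone; exact: TD.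
move=> /RE[_]; rewrite add_lfunE => /eqP.
rewrite paddr_eq0 ?Tb // => /andP[/eqP xb _]; apply: xR; exact/RE.
Qed.

(** A point of the open face is a functional exposing the cone of [T]. Conversely, Farkas supplies
    for each [i] outside [T] a dominant functional vanishing on [T] and positive at [h i], and these
    are added. *)
Lemma facialP T : facial h T <-> exists l, open_face h T l.
Proof.
split=> [[_ _ Tf]|[l lT]].
  (* A point of wall [i] is positive at the other [h j], so all coefficients would vanish and [h i]
     would be 0. *)
  have hT i : i \notin T -> ~ cone_of h T (h i).
    move=> iT [c [c0 hE]]; have [q q0 qp] := wall i.
    have qz : \sum_(j in T) c j * q (h j) = 0.
      rewrite -[RHS]q0 [in RHS]hE linear_sum; apply: eq_bigr => j _;
        by rewrite linearZ.
    have := alpha2 i; rewrite hE big1 ?linear0 => [|j jT]; first by lra.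
    suff -> : c j = 0 by rewrite scale0r.
    have ji : j != i by apply: contraNneq iT => <-.
    move/eqP: qz; rewrite psumr_eq0.
      move=> /allP/(_ j (mem_index_enum _));
        rewrite jT mulf_eq0 [q _ == 0]gt_eqF ?qp //.
      by rewrite orbF => /eqP.
    move=> k kT; rewrite mulr_ge0 ?c0 // ltW // qp //.
    by apply: contraNneq iT => <-.
  have /choice[l lP] : forall i, exists l : Vd,
      [/\ dominant l, forall j, j \in T -> l (h j) = 0 & i \notin T ->
        0 < l (h i)].
    move=> i; have [iT|iT] := boolP (i \in T).
      by exists 0; split=> // [|j _]; [exact: dominant0|rewrite zero_lfunE].
    (* The opposite vectors [- h j] encode vanishing on [T]. *)
    pose x (k : 'I_n + 'I_n) := match k with
      | inl j => h j | inr j => if j \in T then - h j else 0 end.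
    have [[c c0 hE]|[l l0 li]] := farkas [set: 'I_n + 'I_n]%SET x (- h i).
      exfalso.
      have hi : h i + \sum_j c (inl j) *: h j = \sum_(j in T) c (inr j) *: h j.
        have {}hE : - h i = \sum_j c (inl j) *: h j - \sum_(j in T) c (inr j) *:
          h j.
          rewrite hE (eq_bigl xpredT) => [|k]; last by rewrite inE.
          rewrite big_sumType /=; congr (_ + _);
            rewrite -sumrN [RHS]big_mkcond /=.
          apply: eq_bigr => j _; case: ifP => _; first by rewrite scalerN.
          by rewrite scaler0.
        by rewrite -[X in _ + X](subrK (\sum_(j in T) c (inr j) *: h j)) -hE
          addrA subrr add0r.
      have cp (k : ('I_n + 'I_n)%type) : 0 <= c k by apply: c0; rewrite inE.
      have [||_ []] := Tf (h i) (\sum_j c (inl j) *: h j).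
      - split; last exact: hT.
        exists (fun j => (j == i)%:R); split=> [j _|]; first by [].
        rewrite (bigD1 i) ?inE //= eqxx scale1r big1 ?addr0 // =>
          j /andP[_ /negPf ->].
        by rewrite scale0r.
      - exists (fun j => c (inl j)); split=> [j _|]; first exact: cp.
        by apply: eq_bigl => j; rewrite inE.
      - by rewrite hi; exists (fun j => c (inr j)); split.
    exists l; split.
    - by move=> j; apply: (l0 (inl j)); rewrite inE.
    - move=> j jT; apply/eqP; rewrite eq_le (l0 (inl j)) ?inE // andbT.
      by have := l0 (inr j) (finset.in_setT _); rewrite /= jT linearN oppr_ge0.
    - by move=> _; move: li; rewrite linearN oppr_lt0.
  exists (\sum_i l i) => i; case: ifP => iT; rewrite sum_lfunE.
    by rewrite big1 // => j _; have [_ lz _] := lP j; exact: lz.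
  rewrite (bigD1 i) //= ltr_pwDl //; first by have [_ _ lp] := lP i;
    rewrite lp ?iT.
  by rewrite sumr_ge0 // => j _; have [ld _ _] := lP j; exact: ld.
have lpos x : cone_of h [set: 'I_n]%SET x ->
  0 <= l x /\ (l x = 0 -> cone_of h T x).
  move=> [c [c0 ->]].
  have -> : l (\sum_(j in [set: 'I_n]%SET) c j *: h j) =
      \sum_(j in [set: 'I_n]%SET) c j * l (h j).
    by rewrite linear_sum; apply: eq_bigr => j _; rewrite linearZ.
  have p j : j \in [set: 'I_n]%SET -> 0 <= c j * l (h j).
    move=> jI; rewrite mulr_ge0 ?c0 //.
    exact: (closed_face_dominant (open_face_closed lT)).
  split; first exact: sumr_ge0.
  move=> /eqP; rewrite psumr_eq0 // => /allP z; exists c; split=> [j _|].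
    by apply: c0; rewrite inE.
  rewrite (bigID (mem T)) /= [X in _ + X]big1 ?addr0 => [|j /andP[jI jT]].
    by apply: eq_bigl => j; rewrite inE.
  have /implyP/(_ jI) := z j (mem_index_enum _); have := lT j;
    rewrite (negPf jT) => lj.
  by rewrite mulf_eq0 [l _ == 0]gt_eqF // orbF => /eqP ->; rewrite scale0r.
have l0 x : cone_of h T x -> l x = 0.
  move=> [c [_ ->]]; rewrite linear_sum big1 // => j jT.
  by rewrite linearZ /= (closed_face0 (open_face_closed lT) jT) scaler0.
have coneD (U : {set 'I_n}) x y : cone_of h U x -> cone_of h U y ->
  cone_of h U (x + y).
  move=> [c [c0 ->]] [d [d0 ->]]; exists (fun j => c j + d j); split=> [j jU|].
    by rewrite addr_ge0 ?c0 ?d0.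
  by rewrite -big_split; apply: eq_bigr => j _; rewrite scalerDl.
split.
- split=> [x y|t x t0 [c [c0 ->]]]; first exact: coneD.
  exists (fun j => t * c j); split=> [j jT|];
    first by rewrite mulr_ge0 ?c0 // ltW.
  by rewrite scaler_sumr; apply: eq_bigr => j _; rewrite scalerA.
- move=> _ [c [c0 ->]]; exists (fun j => if j \in T then c j else 0);
  split=> [j _|].
    by case: ifP => // /c0.
  rewrite big_mkcond /= [RHS](eq_bigl xpredT) => [|j]; last by rewrite inE.
  by apply: eq_bigr => j _; case: ifP => // _; rewrite scale0r.
- move=> x y [xI xT] yI; split; first exact: coneD.
  move=> /l0; rewrite linearD /= => /eqP; have [lx lx0] := lpos x xI;
    have [ly _] := lpos y yI.
  by rewrite paddr_eq0 // => /andP[/eqP/lx0].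
Qed.

(** * Relative interiors of the faces R(Theta) *)

Lemma sum_alphaE (J : {set 'I_n}) (x : 'I_n -> R) i :
  (\sum_(k in J) x k *: alpha k) (h i) = \sum_(k in J) A i k * x k :> R.
Proof.
rewrite sum_lfunE; apply: eq_bigr => k _.
by rewrite scale_lfunE cartanE mulrC.
Qed.

Lemma sum_alpha_perp (T J : {set 'I_n}) (x : 'I_n -> R) i : J \subset perp A T
  -> i \in T ->
  (\sum_(k in J) x k *: alpha k) (h i) = 0.
Proof.
move=> JT iT; rewrite sum_alphaE big1 // => k kJ.
by rewrite (cartan_eq0C (in_perp (fintype.subsetP JT _ kJ) iT)) mul0r.
Qed.

Lemma open_face_shift (T J : {set 'I_n}) (u : 'I_n -> R) l : J \subset perp A T
  ->
  (forall i, i \in J -> 0 < \sum_(j in J) A i j * u j) ->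
  open_face h (T :|: J)%SET l ->
  exists2 t, 0 < t & open_face h T (l + t *: \sum_(k in J) u k *: alpha k).
Proof.
move=> JT uJ lTJ; set v := \sum_(k in J) _.
have [t t0 ht] := small_perturbation (fun i => l (h i) : R) (fun i => v (h i)).
exists t => // i; rewrite add_lfunE scale_lfunE; have := lTJ i; rewrite inE.
have [iT /= ->|iT /=] := boolP (i \in T).
  by rewrite (sum_alpha_perp _ JT iT) scaler0 addr0.
case: ifP => [iJ ->|_ li]; last by apply: ht; rewrite ?lexx ?ltW.
by rewrite add0r sum_alphaE mulr_gt0 ?uJ.
Qed.

(** The directions pointing from [l] into the face are pulled back along [p] to coordinate vectors.
    They are invariant because the reflections in [J] fix [l] and preserve [Rset T]. *)
Lemma Rset_opposite (T J : {set 'I_n}) (u : 'I_n -> R) l : infinite_type A T ->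
  J \subset perp A T ->
  (forall j, j \in J -> 0 < u j) ->
  (forall i, i \in J -> 0 < \sum_(j in J) A i j * u j) ->
  open_face h (T :|: J)%SET l ->
  exists2 t, 0 < t & Rset T (l - t *: \sum_(k in J) u k *: alpha k).
Proof.
move=> iT JT u0 uJ lTJ.
(* The block of [J] is completed by diagonal entries 2 so that the invariant-cone lemma applies to
   all [n] coordinates; [p] ignores those outside [J]. *)
pose B : 'M[R]_n := \matrix_(i, j)
  if (i \in J) && (j \in J) then A i j else if i == j then 2 else 0.
pose w : 'cV[R]_n := \col_i if i \in J then u i else 1.
pose p (x : 'cV[R]_n) := \sum_(k in J) x k 0 *: alpha k.
have BJ x i : i \in J -> (B *m x) i 0 = p x (h i).
  move=> iJ; rewrite mxE sum_alphaE (bigID (mem J)) /= [X in _ + X]big1 ?addr0.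
    by apply: eq_bigr => k kJ; rewrite mxE iJ kJ.
  move=> k kJ; rewrite mxE iJ (negPf kJ) /=; case: eqVneq kJ => [<-|_ _].
    by rewrite iJ.
  by rewrite mul0r.
have BnJ x i : i \notin J -> (B *m x) i 0 = 2 * x i 0.
  move=> iJ; rewrite mxE (bigD1 i) //= big1 => [|k ki].
    by rewrite mxE (negPf iJ) eqxx addr0.
  by rewrite mxE (negPf iJ) eq_sym (negPf ki) mul0r.
have pD a b x y : p (a *: x + b *: y) = a *: p x + b *: p y.
  rewrite /p !scaler_sumr -big_split; apply: eq_bigr => k _ /=.
  by rewrite !mxE scalerDl !scalerA.
have [RD RZ] := Rset_convex_cone iT.
have pw : p w = \sum_(k in J) u k *: alpha k.
  by apply: eq_bigr => k kJ; rewrite mxE kJ.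
pose Z : set 'cV[R]_n := [set x | exists2 t, 0 < t & Rset T (l + t *: p x)].
suff [t t0 Rt] : Z (- w).
  exists t => //; rewrite -scalerN -pw; suff <- : p (- w) = - p w by [].
  by have := pD (-1) 0 w 0; rewrite scaler0 scale0r !addr0 !scaleN1r.
apply: (reflection_invariant_cone (B := B) (u := w)) => [i|i|i||x Bx|x j].
- by rewrite mxE eqxx; case: ifP; rewrite ?cartan2.
- by rewrite mxE; case: ifP => // /u0.
- have [iJ|iJ] := boolP (i \in J).
    by rewrite BJ // pw sum_alphaE uJ.
  by rewrite BnJ // mxE (negPf iJ) mulr1.
- split=> [x y [s s0 Rs] [t t0 Rt]|a x a0 [s s0 Rs]].
    have st : 0 < s + t by rewrite addr_gt0.
    have st0 : s + t != 0 by rewrite gt_eqF.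
    (* Weights t/(s+t) and s/(s+t) bring both steps to this common value. *)
    exists (s * t / (s + t)); first by rewrite divr_gt0 ?mulr_gt0.
    have -> : l + (s * t / (s + t)) *: p (x + y) =
        (t / (s + t)) *: (l + s *: p x) + (s / (s + t)) *: (l + t *: p y).
      rewrite -{1}[x]scale1r -{1}[y]scale1r pD !scalerDr !scalerA addrACA
        -scalerDl.
      have -> : t / (s + t) + s / (s + t) = 1 by field.
      have -> : t / (s + t) * s = s * t / (s + t) by field.
      have -> : s / (s + t) * t = s * t / (s + t) by field.
      by rewrite scale1r !mulr1.
    by apply: RD; apply: RZ => //; rewrite divr_gt0.
  exists (s / a); first by rewrite divr_gt0.
  by have := pD a 0 x 0; rewrite scaler0 addr0 scale0r addr0 => ->;
    rewrite scalerA divfK ?gt_eqF.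
- have [t t0 ht] := small_perturbation (fun i => l (h i) : R)
  (fun i => p x (h i)).
  exists t => //; apply: closed_face_Rset => i; rewrite add_lfunE scale_lfunE.
  have := lTJ i; rewrite inE; have [iT' /= ->|iT' /=] := boolP (i \in T).
    by rewrite (sum_alpha_perp _ JT iT') scaler0 addr0.
  case: ifP => [iJ ->|_ li]; last by apply/ltW/ht; rewrite ?lexx ?ltW.
  by rewrite add0r mulr_ge0 ?(ltW t0) // -BJ.
- move=> [t t0 Rt]; exists t => //.
  have -> : x - (B *m x) j 0 *: delta_mx j 0 = 1 *: x + (- (B *m x) j 0) *:
    delta_mx j 0.
    by rewrite scale1r scaleNr.
  rewrite pD scale1r; have [jJ|jJ] := boolP (j \in J); last first.
    suff -> : p (delta_mx j 0) = 0 by rewrite scaler0 addr0.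
    rewrite /p big1 // => k kJ; rewrite mxE; case: eqVneq kJ => [->|_ _];
      last by rewrite scale0r.
    by rewrite (negPf jJ).
  have -> : p (delta_mx j 0) = alpha j.
    rewrite /p (bigD1 j) //= mxE !eqxx scale1r big1 ?addr0 // =>
      k /andP[_ /negPf kj].
    by rewrite mxE kj scale0r.
  have lj : l (h j) = 0 by have := lTJ j; rewrite inE jJ orbT.
  have := Rset_word_act (s := [:: j]) _ Rt;
    rewrite /= (fintype.subsetP JT) // => /(_ isT).
  suff -> : simple_refl j (l + t *: p x) = l + t *:
    (p x + - (B *m x) j 0 *: alpha j) by [].
  rewrite /simple_refl add_lfunE scale_lfunE lj add0r -BJ // scalerDr scalerA
    addrA.
  by rewrite mulrN scaleNr.
Qed.

(** [l] lies between [l - t *: v] in the face and [l + s *: v] in the open face of [T]. From the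
    latter a multiple of [y] can be subtracted, and the convex combination that cancels [v]
    transfers this to [l]. *)
Lemma open_face_relint (T J : {set 'I_n}) l : infinite_type A T ->
  finite_type A J ->
  J \subset perp A T -> open_face h (T :|: J)%SET l -> relint (Rset T) l.
Proof.
move=> iT [u [u0 uJ]] JT lTJ; have Rc := Rset_convex_cone iT.
rewrite relint_convex_cone //; last exact: Rset_0.
have lR : Rset T l.
  apply: closed_face_Rset => i; have := lTJ i; rewrite inE;
    case: (i \in T) => //=.
  by case: ifP => _ => [->|/ltW].
split=> // y yR.
have [t t0 Rt] := Rset_opposite iT JT u0 uJ lTJ.
have [s s0 ls] := open_face_shift JT uJ lTJ; move: Rt ls.
set v := \sum_(k in J) _ => Rt ls.
have [r r0 hr] := small_perturbation (fun i => (l + s *: v) (h i) : R)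
  (fun i => - y (h i)).
have Rr : Rset T (l + s *: v - r *: y).
  apply: closed_face_Rset => i; rewrite add_lfunE opp_lfunE scale_lfunE.
  have := ls i; case: ifP => iT' li; first by rewrite li (Rset0 yR iT') scaler0
    subr0.
  by rewrite -scalerN; apply/ltW/hr; rewrite ?lexx ?ltW.
have st : 0 < s + t by rewrite addr_gt0.
have st0 : s + t != 0 by rewrite gt_eqF.
exists (t * r / (s + t)); first by rewrite divr_gt0 ?mulr_gt0.
have -> : l - (t * r / (s + t)) *: y =
    (s / (s + t)) *: (l - t *: v) + (t / (s + t)) *: (l + s *: v - r *: y).
  rewrite !scalerBr !scalerDr !scalerA addrA addrACA -scalerDl.
  have -> : s / (s + t) + t / (s + t) = 1 by field.
  have -> : t / (s + t) * s = s / (s + t) * t by field.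
  have -> : t * r / (s + t) = t / (s + t) * r by field.
  by rewrite addNr addr0 scale1r.
by apply: (proj1 Rc); apply: (proj2 Rc) => //; rewrite divr_gt0.
Qed.

Lemma zero_set_split l : dominant l ->
  exists P Q : {set 'I_n}, [/\ finite_type A P, infinite_type A Q,
    P \subset perp A Q
    & open_face h (Q :|: P)%SET l].
Proof.
move=> ld; pose J := [set i | l (h i) == 0 :> R]%SET.
have fi := fin_inf_partU A J.
exists (fin_part A J), (inf_part A J); split.
- exact: (finite_type_fin_part cartan2 cartan_eq0C).
- exact: (infinite_type_inf_part cartan2 cartan_le0 cartan_eq0C).
- apply/fintype.subsetP => i iP; rewrite inE; apply/forall_inP => j jQ;
  apply/eqP.
  exact: (fin_inf_part_separated cartan_eq0C iP jQ).
- move=> i; rewrite finset.setUC -fi inE; case: eqP => // /eqP li.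
  by rewrite lt0r li; exact: ld.
Qed.

(** The zero set of [l] splits into [P] of finite and [Q] of infinite type; the point is Q = T. The
    functional attached to [Q] vanishes at [l] and is nonnegative at [l - t *: q], so [q] in the
    open face of [T] vanishes on [Q], whence Q is contained in T. The other inclusion is
    [infinite_type_disjoint]. *)
Lemma relint_Rset T x : infinite_type A T -> facial h T -> relint (Rset T) x ->
  exists2 s, all [in perp A T] s & exists P l,
    [/\ finite_type A P, P \subset perp A T,
    open_face h (T :|: P)%SET l & x = word_act s l].
Proof.
move=> iT /facialP[q qT]; rewrite relint_convex_cone; last first.
- exact: Rset_0.
- exact: Rset_convex_cone.
move=> [[s sT [l lT ->]] hx]; exists s => //.
have ld := closed_face_dominant lT.
have [P [Q [fP iQ PQ lPQ]]] := zero_set_split ld.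
have hl y : Rset T y -> exists2 t : R, 0 < t & Rset T (l - t *: y).
  move=> yR; have [t t0 Rt] := hx _ (Rset_word_act sT yR); exists t => //.
  have := Rset_word_act (s := rev s) _ Rt; rewrite all_rev => /(_ sT).
  by rewrite -scaleNr word_actD word_actZ !word_act_revK scaleNr.
have QT : Q \subset T.
  have [c c0 /(_ _ erefl)[Tb _]] := infinite_type_functional iQ.
  have qR := closed_face_Rset (open_face_closed qT).
  have [t t0 /Rset_Tits/Tb] := hl q qR.
  have bE (m : Vd) : m (\sum_(j in Q) c j *: h j) = \sum_(j in Q) c j * m (h j).
    by rewrite linear_sum; apply: eq_bigr => j _; rewrite linearZ.
  rewrite add_lfunE opp_lfunE scale_lfunE !bE big1 ?sub0r => [|j jQ];
    last first.
    by have := lPQ j; rewrite inE jQ => ->; rewrite mulr0.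
  rewrite oppr_ge0 /GRing.scale /= pmulr_rle0 // => qb.
  apply/fintype.subsetP => i iQ'; apply: contraLR qb => iT'; rewrite -ltNge.
  rewrite (bigD1 i) //= ltr_pwDl //.
    by rewrite mulr_gt0 ?c0 //; have := qT i; rewrite (negPf iT').
  apply: sumr_ge0 => j /andP[jQ _]; rewrite mulr_ge0 ?(ltW (c0 _ jQ)) //.
  exact: (closed_face_dominant (open_face_closed qT)).
have TQ : T \subset Q.
  apply: (infinite_type_disjoint cartan_le0 cartan_eq0C fP iT).
    apply/fintype.subsetP => i iT'; rewrite finset.setUC; apply: contraT => iPQ.
    by have := lPQ i; rewrite (negPf iPQ) (closed_face0 lT iT') ltxx.
  by move=> i j /(fintype.subsetP PQ) iP jQ; exact: in_perp iP jQ.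
have QTE : Q = T by apply/eqP; rewrite finset.eqEsubset QT TQ.
by exists P, l; rewrite -QTE.
Qed.

(** With [Q] the infinite part of the zero set of [l], this point is in the relative interiors of
    both [F] and [Rset Q]. Shifting [l] off the walls of [P] shows that [Q] is facial. *)
Lemma dominant_relint_face F l : Fa Tits F -> relint F l -> dominant l ->
  exists2 T, infinite_type A T /\ facial h T & F = Rset T.
Proof.
move=> FF lF ld; have [P [Q [fP iQ PQ lPQ]]] := zero_set_split ld.
have lQ := open_face_relint iQ fP PQ lPQ.
have QF := Rset_face iQ.
exists Q.
  split=> //; apply/facialP; have [u [_ uP]] := fP.
  by have [t _ ?] := open_face_shift PQ uP lPQ;
    exists (l + t *: \sum_(k in P) u k *: alpha k).
apply/seteqP; split.
  by apply: (relint_face_sub Tits0 FF QF lF); case: lQ.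
by apply: (relint_face_sub Tits0 QF FF lQ); case: lF.
Qed.

(** * Orbits of faces *)

Lemma word_act_convex_cone s (K : set Vd) : convex_cone K ->
  convex_cone [set word_act s y | y in K].
Proof.
move=> [KD KZ]; split=> [_ _ [y Ky <-] [z Kz <-]|t _ t0 [y Ky <-]].
  by exists (y + z); [exact: KD|rewrite word_actD].
by exists (t *: y); [exact: KZ|rewrite word_actZ].
Qed.

Lemma relint_word_act (K : set Vd) s x : convex_cone K -> K 0 ->
  relint [set word_act s y | y in K] x -> relint K (word_act (rev s) x).
Proof.
move=> Kc K0; rewrite !relint_convex_cone //.
- move=> [[y Ky <-] hy]; rewrite word_act_revK; split=> // z Kz.
  have [|t t0 [z' Kz' E]] := hy (word_act s z); first by exists z.
  exists t => //; suff <- : z' = y - t *: z by [].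
  apply: (can_inj (word_act_revK s)).
  by rewrite E -[- (t *: z)]scaleNr word_actD word_actZ scaleNr.
- exact: word_act_convex_cone.
- by exists 0; rewrite ?word_act0.
Qed.

(** A point of the open face of [T] is carried to a dominant point of the open face of T' together
    with some [P] of finite type. Dominant points of one orbit coincide, so T is the union of T' and
    [P]; being of infinite type, it lies in T'. *)
Lemma Rset_orbit_inj T T' s : infinite_type A T -> facial h T ->
  infinite_type A T' -> facial h T' -> Rset T =
    [set word_act s y | y in Rset T'] -> T = T'.
Proof.
move=> iT fT iT' fT' E; have [p pT] := proj1 (facialP T) fT.
have f0 : finite_type A finset.set0.
  by exists (fun=> 1); split=> i; rewrite inE.
have pR : relint (Rset T) p.
  by apply: (open_face_relint iT f0); rewrite ?finset.sub0set ?finset.setU0.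
rewrite E in pR; have [t tT [P [l [fP PT lP pE]]]] :=
  relint_Rset iT' fT' (relint_word_act (Rset_convex_cone iT') (Rset_0 T') pR).
have pl : p = word_act (s ++ t) l by rewrite word_act_cat -pE word_actK.
have ld : dominant l := closed_face_dominant (open_face_closed lP).
have pd : dominant p := closed_face_dominant (open_face_closed pT).
have {}pl : p = l by rewrite pl dominant_orbit // -pl.
have TE : T = (T' :|: P)%SET.
  apply/finset.setP => i; have := pT i; have := lP i; rewrite -pl.
  by do 2![case: ifP => _] => // [-> | pi pi0]; rewrite ?ltxx //; move: pi;
    rewrite pi0 ltxx.
apply/eqP; rewrite finset.eqEsubset {2}TE finset.subsetUl andbT.
apply: (infinite_type_disjoint cartan_le0 cartan_eq0C fP iT).
  by rewrite TE finset.setUC fintype.subxx.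
by move=> i j /(fintype.subsetP PT) iP jT; exact: in_perp iP jT.
Qed.

Lemma word_act_image s (K : set Vd) :
  [set word_act (rev s) y | y in [set word_act s y | y in K]] = K.
Proof.
apply/seteqP; split=> [_ [_ [y Ky <-] <-]|y Ky]; first by rewrite word_act_revK.
by exists (word_act s y); [exists y|rewrite word_act_revK].
Qed.

Lemma relint_word_act_image s (K : set Vd) x : convex_cone K -> K 0 ->
  relint K x ->
  relint [set word_act s y | y in K] (word_act s x).
Proof.
move=> Kc K0 Kx; rewrite -{2}[s]revK; apply: relint_word_act.
- exact: word_act_convex_cone.
- by exists 0; rewrite ?word_act0.
- by rewrite word_act_image.
Qed.

Lemma Rset_word_act_image T s : all [in perp A T] s ->
  [set word_act s y | y in Rset T] = Rset T.
Proof.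
move=> sT; apply/seteqP; split=> [_ [y yR <-]|y yR]; first exact: Rset_word_act.
exists (word_act (rev s) y); last exact: word_actK.
by apply: Rset_word_act; rewrite ?all_rev.
Qed.

Lemma word_act_face s F : Fa Tits F -> Fa Tits [set word_act s y | y in F].
Proof.
move=> [[Fc FT Ff] [y0 Fy0]]; split; last by exists (word_act s y0), y0.
split; first exact: word_act_convex_cone.
  by move=> _ [y Fy <-]; apply: Tits_word_act; exact: FT.
move=> x y [xT xF] yT.
have [||zT zF] := Ff (word_act (rev s) x) (word_act (rev s) y).
- split; first exact: Tits_word_act.
  by move=> Fx; apply: xF; exists (word_act (rev s) x); rewrite ?word_actK.
- exact: Tits_word_act.
split; first by have [TD _] := Tits_convex_cone; exact: TD.
by move=> [z Fz zE]; apply: zF; rewrite -word_actD -zE word_act_revK.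
Qed.

(** Some translate of a relatively interior point of [F] is dominant. *)
Lemma face_orbit F : Fa Tits F -> exists s T,
  [/\ infinite_type A T, facial h T & Rset T = [set word_act s y | y in F]].
Proof.
move=> FF; have F0 := face_0 Tits0 FF; have [[Fc FT _] _] := FF.
have [x xF] := relint_convex_cone_nonempty Fc F0.
have [s [l [ld xE]]] : Tits x by apply: FT; case: xF.
have lF : relint [set word_act (rev s) y | y in F] l.
  by rewrite -(word_act_revK s l) -xE; exact: relint_word_act_image.
have [T [iT fT] TE] := dominant_relint_face (word_act_face (rev s) FF) lF ld.
by exists (rev s), T.
Qed.

Lemma face_orbit_inj F s s' T T' : infinite_type A T -> facial h T ->
  infinite_type A T' -> facial h T' -> Rset T = [set word_act s y | y in F] ->
  Rset T' = [set word_act s' y | y in F] -> T = T'.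
Proof.
move=> iT fT iT' fT' E E'; apply: (@Rset_orbit_inj _ _ (s ++ rev s')) => //.
rewrite E E'; apply/seteqP; split=> [_ [y Fy <-]|_ [_ [y Fy <-] <-]];
  last first.
  by exists y; rewrite // word_act_cat word_act_revK.
by exists (word_act s' y); [exists y|rewrite word_act_cat word_act_revK].
Qed.

Lemma facial_relint T : infinite_type A T -> facial h T ->
  exists2 l, relint (Rset T) l & dominant l.
Proof.
move=> iT /facialP[p pT]; exists p; last exact: closed_face_dominant
  (open_face_closed pT).
apply: (@open_face_relint T finset.set0);
  rewrite ?finset.sub0set ?finset.setU0 //.
by exists (fun=> 1); split=> i; rewrite inE.
Qed.

End Reflections.

(** * Translation to linear Coxeter systems *)

HB.instance Definition _ (R : realType) (V : vectType R) n (h : 'I_n -> V)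
    (alpha : 'I_n -> 'Hom(V, R^o)) i :=
  GRing.isLinear.Build R _ _ _ (simple_refl h alpha i)
    (simple_refl_is_linear h alpha i).

Definition evaluation (R : realType) (V : vectType R) (v : V) (l : 'Hom(V, R^o))
  : R^o := l v.

Lemma evaluation_is_linear (R : realType) (V : vectType R) (v : V) : linear
  (evaluation v).
Proof. by move=> a l m; rewrite /evaluation add_lfunE scale_lfunE. Qed.

HB.instance Definition _ (R : realType) (V : vectType R) (v : V) :=
  GRing.isLinear.Build R _ _ _ (evaluation v) (evaluation_is_linear v).

Section LinearCoxeterSystem.
Context (R : realType) (V : vectType R) (n : nat).
Local Notation Vd := 'Hom(V, R^o).
Variables (H : 'I_n -> set V) (L : 'I_n -> set Vd) (h : 'I_n -> V)
  (alpha : 'I_n -> Vd).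
Hypotheses (HL : linear_coxeter_system H L) (Hh : forall i, H i (h i))
  (La : forall i, L i (alpha i)) (alpha2 : forall i, alpha i (h i) = 2).

Lemma root_neq0 i : h i != 0.
Proof. by apply/eqP => h0; have := alpha2 i; rewrite h0 linear0; lra. Qed.

Lemma rayP i x : H i x -> exists2 t : R, 0 <= t & x = t *: h i.
Proof.
have [v v0 HE] := lcs_H_ray HL i; have := Hh i;
  rewrite HE => -[a a0 hE] [t t0 <-].
have an : a != 0 by apply: contraNneq (root_neq0 i) => z; rewrite -hE z scale0r.
exists (t / a); first exact: divr_ge0.
by rewrite -hE scalerA divfK.
Qed.

Lemma coray_line i x : (L i `|` [set - l | l in L i]) x -> exists t : R,
  x = t *: alpha i.
Proof.
have [v v0 LE] := lcs_L_ray HL i; have := La i; rewrite LE => -[a a0 aE].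
have an : a != 0.
  apply/eqP => z; have := alpha2 i; rewrite -aE z scale0r zero_lfunE; lra.
move=> [[t _ <-]|[_ [t _ <-] <-]]; [exists (t / a)|exists (- (t / a))];
  rewrite -aE ?scaleNr scalerA divfK //.
Qed.

Lemma coray_scale i (t : R) : (L i `|` [set - l | l in L i]) (t *: alpha i).
Proof.
have [v v0 LE] := lcs_L_ray HL i; have := La i; rewrite LE => -[a a0 <-].
rewrite scalerA; have [t0|t0] := leP 0 t.
  by left; exists (t * a) => //; rewrite /= mulr_ge0.
right; exists (- (t * a) *: v); last by rewrite scaleNr opprK.
by exists (- (t * a)) => //=; rewrite oppr_ge0 mulr_le0_ge0 // ltW.
Qed.

Lemma ray_eq0E i l : ray_eq0 (H i) l <-> l (h i) = 0.
Proof.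
split=> [|l0 x /rayP[t _ ->]]; first exact.
by rewrite linearZ /= l0 scaler0.
Qed.

Lemma closed_chamberE : closed_chamber H = dominant h.
Proof.
apply/seteqP; split=> l ld.
  by move=> i; exact: (ld i I (h i) (Hh i)).
move=> i _ x /rayP[t t0 ->]; rewrite linearZ /= mulr_ge0 //; exact: ld.
Qed.

Lemma open_chamberE : open_chamber H = strictly_dominant h.
Proof.
apply/seteqP; split=> l ld.
  by move=> i; apply: (ld i I (h i) (Hh i)); apply/eqP/root_neq0.
move=> i _ x /rayP[t t0 ->] z; rewrite linearZ /= mulr_gt0 //.
by rewrite lt0r t0 andbT; apply/eqP => t1; apply: z; rewrite t1 scale0r.
Qed.

Lemma subr_half (W : lmodType R) (x y : W) (a : R) :
  x - (a / 2) *: y - (a / 2) *: y = x - a *: y.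
Proof. by rewrite -addrA -opprD -scalerDl -splitr. Qed.

Lemma is_sigmaE i (s : 'End(Vd)) : is_sigma H L i s <->
  s =1 simple_refl h alpha i.
Proof.
split=> [[s1 s2] x|sE].
  (* As [alpha i (h i)] = 2, half of the value at [h i] is the coefficient that splits [x] into its
     parts in the hyperplane and on the line. *)
  have -> : s x = s ((x - (x (h i) / 2 : R) *: alpha i) + (x (h i) / 2 : R) *:
    alpha i).
    by rewrite subrK.
  rewrite linearD /= s1 ?s2; last 2 first.
  - exact: coray_scale.
  - apply/ray_eq0E; rewrite add_lfunE opp_lfunE scale_lfunE alpha2 /GRing.scale
    /=.
    by rewrite divfK ?subrr // pnatr_eq0.
  exact: subr_half.
split=> x; first by move=> /ray_eq0E x0; rewrite sE simple_refl_id.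
move=> /coray_line[t ->]; rewrite sE
  -[simple_refl _ _ _ _]/(word_act h alpha [:: i] _).
rewrite word_actZ /= /simple_refl alpha2 scaler_nat mulr2n opprD addrA subrr
  add0r.
by rewrite scalerN.
Qed.

Lemma parabolic_word_act (J : {set 'I_n}) (w : 'End(Vd)) : parabolic H L J w ->
  exists2 s, all [in J] s & forall x, w x = word_act h alpha s x.
Proof.
pose M : set 'End(Vd) := [set w | exists2 s, all [in J] s & forall x,
  w x = word_act h alpha s x].
move=> /(_ M); apply; split; last first.
  move=> s [i iJ /is_sigmaE sE]; exists [:: i] => //=; by rewrite iJ.
split.
- move=> g [s _ gE]; apply/eqP/lker0P => x y; rewrite !gE.
  exact: (can_inj (word_act_revK alpha2 s)).
- by exists [::] => // x; rewrite id_lfunE.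
- move=> f g [s sJ fE] [t tJ gE]; exists (s ++ t); first by rewrite all_cat sJ.
  by move=> x; rewrite comp_lfunE fE gE word_act_cat.
- move=> g [s sJ gE]; exists (rev s); first by rewrite all_rev.
  move=> x; rewrite -{1}[x](word_actK alpha2 s) -gE lker0_lfunK //.
  apply/lker0P => y z; rewrite !gE; exact: (can_inj (word_act_revK alpha2 s)).
Qed.

Lemma word_act_parabolic (J : {set 'I_n}) s : all [in J] s ->
  exists2 w : 'End(Vd), parabolic H L J w & w =1 word_act h alpha s.
Proof.
elim: s => [_|i s IH /= /andP[iJ /IH[w wJ wE]]].
  exists \1%VF; last first.
    by move=> x; rewrite id_lfunE /=.
  by move=> M [[_ M1 _ _] _].
pose r := linfun (simple_refl h alpha i);
  have rE x : r x = simple_refl h alpha i x.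
  by rewrite lfunE.
exists (r \o w)%VF; last by move=> x; rewrite comp_lfunE rE wE.
move=> M MS; have [[Mk M1 MM MV] SM] := MS; apply: MM; last exact: (wJ M MS).
by apply: SM; exists i => //; apply/is_sigmaE => x; rewrite rE.
Qed.

Lemma translates_parabolic (J : {set 'I_n}) (S : set Vd) :
  translates (parabolic H L J) S =
  [set x | exists2 s, all [in J] s & exists2 l, S l & x = word_act h alpha s l].
Proof.
apply/seteqP; split=> x.
  by move=> [w /parabolic_word_act[s sJ wE] [l Sl <-]]; exists s => //;
    exists l; rewrite ?wE.
move=> [s /word_act_parabolic[w wJ wE] [l Sl ->]].
by exists w => //; exists l; rewrite ?wE.
Qed.

Lemma RfaceE T : Rface H L h alpha T = Rset h alpha T.
Proof. exact: translates_parabolic. Qed.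

Lemma tits_coneE : tits_cone H L = Tits h alpha.
Proof.
rewrite /tits_cone /coxeter_group translates_parabolic closed_chamberE.
apply/seteqP; split=> x [s]; first by move=> _ [l ld ->]; exists s, l.
by move=> [l [ld ->]]; exists s; [apply/allP => i _; rewrite inE|exists l].
Qed.

Lemma word_act_coxeter s :
  exists2 w : 'End(Vd), coxeter_group H L w & w =1 word_act h alpha s.
Proof. by apply: word_act_parabolic; apply/allP => i _; rewrite inE. Qed.

Lemma word_act_free s l : strictly_dominant h l ->
  strictly_dominant h (word_act h alpha s l) -> word_act h alpha s =1 id.
Proof.
move=> ld sld; have [w wW wE] := word_act_coxeter s.
have [w1|/(lcs_free HL wW) w1] := pselect (w = \1%VF).
  by move=> x; rewrite -wE w1 id_lfunE.
have : set0 (word_act h alpha s l); last by [].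
by rewrite -w1 open_chamberE; split=> //; exists l.
Qed.

(** Were every dominant functional zero at [h i], the chamber would span at most the kernel of
    evaluation at [h i], which misses [alpha i]. *)
Lemma chamber_point : exists l, strictly_dominant h l.
Proof.
have /choice[l lP] : forall i, exists l : Vd, dominant h l /\ 0 < l (h i).
  move=> i; apply: contrapT => /forallNP hn.
  have : ({:Vd} <= lker (linfun (evaluation (h i))))%VS.
    apply: (lcs_chamber_span HL).2 => x.
    rewrite closed_chamberE => xd; rewrite memv_ker lfunE /= /evaluation.
    rewrite eq_le (xd i) andbT leNgt; apply/negP => xi; exact: (hn x).
  move=> /subvP/(_ (alpha i) (memvf _)); rewrite memv_ker lfunE /= /evaluation.
  by rewrite alpha2 pnatr_eq0.
exists (\sum_i l i) => i; rewrite sum_lfunE (bigD1 i) //= ltr_pwDl ?(lP i).2 //.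
by rewrite sumr_ge0 // => j _; exact: (lP j).1.
Qed.

(** Wall [i] has codimension 1, so it spans the kernel of evaluation at [h i]. If it also vanished
    at [h j], the two kernels would agree, and with them walls [i] and [j]. *)
Lemma wall_point i :
  exists2 l : Vd, l (h i) = 0 & forall j, j != i -> 0 < l (h j).
Proof.
pose Ker j := lker (linfun (evaluation (h j))).
have kerE j l : (l \in Ker j) = (l (h j) == 0 :> R).
  by rewrite memv_ker lfunE.
pose F j := closed_chamber H `&` ray_eq0 (H j).
have FE j l : F j l <-> dominant h l /\ l (h j) = 0.
  by rewrite /F closed_chamberE; split=> -[ld l0]; split=> //; apply/ray_eq0E.
have [UK [UF [[sK _] [sF spF] dUF]]] : exists UK UF : {vspace Vd},
    [/\ is_span (closed_chamber H) UK, is_span (F i) UF & (\dim UF).+1 = \dim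
      UK].
  have : codim1_face (closed_chamber H) (F i) by rewrite -(lcs_walls HL);
    exists i.
  by case.
have UKE : (\dim {:Vd} <= \dim UK)%N.
  by apply: dimvS; exact: (lcs_chamber_span HL).2.
have kerUF j : (UF <= Ker j)%VS -> UF = Ker j.
  move=> UFj; apply/eqP; rewrite -(geq_leqif (dimv_leqif_eq UFj)) -ltnS dUF.
  apply: leq_trans UKE; rewrite ltnNge; apply/negP => d.
  have : alpha j \in Ker j.
    have := geq_leqif (dimv_leqif_eq (subvf (Ker j)));
      rewrite d => /esym/eqP ->.
    exact: memvf.
  by rewrite kerE alpha2 pnatr_eq0.
have UFi : UF = Ker i.
  apply: kerUF; apply: spF => l /FE[_ l0]; by rewrite kerE l0.
have /choice[l lP] : forall j, exists l : Vd,
    [/\ dominant h l, l (h i) = 0 & j != i -> 0 < l (h j)].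
  move=> j; have [->|ji] := eqVneq j i.
    by exists 0; split=> // [k|]; rewrite zero_lfunE.
  apply: contrapT => /forallNP hn.
  have UFj : UF = Ker j.
    apply: kerUF; apply: spF => l /FE[ld l0]; rewrite kerE eq_le ld andbT leNgt.
    by apply/negP => lj; apply: (hn l).
  case/eqP: ji; apply: (lcs_wall_inj HL); apply/seteqP.
  have kij (l : Vd) : (l (h j) == 0 :> R) = (l (h i) == 0 :> R) by rewrite
    -!kerE -UFj -UFi.
  by split=> l /FE[ld /eqP l0]; apply/FE; split=> //; apply/eqP;
    [rewrite -kij|rewrite kij].
exists (\sum_j l j) => [|j ji]; rewrite sum_lfunE.
  by rewrite big1 // => j _; have [] := lP j.
rewrite (bigD1 j) //= ltr_pwDl //; first by have [_ _ ->] := lP j.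
by rewrite sumr_ge0 // => k _; have [ld _ _] := lP k; exact: ld.
Qed.

End LinearCoxeterSystem.

Theorem theorem3p55 (R : realType) (V : vectType R) (n : nat)
    (H : 'I_n -> set V) (L : 'I_n -> set 'Hom(V, R^o))
    (h : 'I_n -> V) (alpha : 'I_n -> 'Hom(V, R^o)) :
  linear_coxeter_system H L ->
  (forall i, H i (h i)) -> (forall i, L i (alpha i)) ->
  (forall i, alpha i (h i) = 2) ->
  (forall Theta : {set 'I_n}, special_facial h alpha Theta ->
     relint (Rface H L h alpha Theta) =
     translates (parabolic H L (perp (cartan_mx h alpha) Theta))
       (\bigcup_(Thetaf in
            [set J : {set 'I_n} | J \subset perp (cartan_mx h alpha) Theta /\
                                  fin_part (cartan_mx h alpha) J = J])
          open_face h (Theta :|: Thetaf)%SET)) /\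
  (forall F : set 'Hom(V, R^o), Fa (tits_cone H L) F ->
     exists! Theta : {set 'I_n},
       special_facial h alpha Theta /\
       exists2 w : 'End('Hom(V, R^o)), coxeter_group H L w &
         Rface H L h alpha Theta = [set w x | x in F]) /\
  (forall F : set 'Hom(V, R^o), Fa (tits_cone H L) F ->
     ((exists2 Theta : {set 'I_n},
         special_facial h alpha Theta & F = Rface H L h alpha Theta) <->
      relint F `&` closed_chamber H !=set0)).
Proof.
move=> HL Hh La a2.
have ch := chamber_point HL Hh a2.
have wa := wall_point HL Hh a2.
have fr := word_act_free HL Hh La a2.
have A2 := cartan2 a2.
have Ale := cartan_le0 a2 ch wa fr.
have A0C := cartan_eq0C a2 ch wa fr.
have spE (T : {set 'I_n}) : special_facial h alpha T <->
    infinite_type (cartan_mx h alpha) T /\ facial h T.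
  by split=> -[sT fT]; split=> //; apply/(special_infinite_type A2 Ale A0C).
rewrite (tits_coneE HL Hh La a2) (closed_chamberE HL Hh a2).
have RE := RfaceE HL Hh La a2; split; [|split].
- move=> T /spE[iT fT]; rewrite RE (translates_parabolic HL Hh La a2).
  apply/seteqP; split=> x.
    move=> /(relint_Rset a2 ch wa fr iT fT)[s sT [P [l [fP PT lP ->]]]].
    exists s => //; exists l => //; exists P => //; split=> //.
    exact/(fin_part_id A2 Ale A0C).
  move=> [s sT [l [P [PT /(fin_part_id A2 Ale A0C) fP] lP] ->]].
  have lR := open_face_relint a2 ch wa fr iT fP PT lP.
  have := relint_word_act_image a2 s (Rset_convex_cone a2 ch wa fr iT)
    (Rset_0 h alpha T) lR.
  by rewrite Rset_word_act_image.
- move=> F FF; have [s [T [iT fT TE]]] := face_orbit a2 ch wa fr FF.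
  have imE (w : 'End('Hom(V, R^o))) t : w =1 word_act h alpha t ->
      [set w x | x in F] = [set word_act h alpha t x | x in F].
    by move=> wE; apply: eq_imagel => x _; exact: wE.
  exists T; split.
    split; first exact/spE.
    have [w wW wE] := word_act_coxeter HL Hh La a2 s.
    by exists w => //; rewrite RE TE -(imE w).
  move=> T' [/spE[iT' fT'] [w /(parabolic_word_act HL Hh La a2)[s' _ wE]]].
  rewrite RE (imE w s') // => TE'.
  exact: (face_orbit_inj a2 ch wa fr iT fT iT' fT' TE TE').
- move=> F FF; split=> [[T /spE[iT fT] ->]|[l [lF ld]]].
    by have [l lR ld] := facial_relint a2 ch wa fr iT fT; exists l; rewrite RE.
  have [T sT TE] := dominant_relint_face a2 ch wa fr FF lF ld.
  by exists T; [exact/spE|rewrite RE].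
Qed.
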